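(* Let $n\ge 3$ and let $C=\Gamma_1\cup\Gamma_2$ be a general binary curve in $\mathbb{P}^n$ (canonically embedded, of arithmetic genus $n+1$). Then there is no rational normal scroll of minimal degree and of dimension $\le\frac{n}{2}$ in $\mathbb{P}^n$ containing $C$.
   Context: Work over $\mathbb{C}$. A binary curve is a stable curve $C=\Gamma_1\cup\Gamma_2$ with $\Gamma_i\cong\mathbb{P}^1$ for $i=1,2$, the two components intersecting transversally in $n+2$ distinct points; its arithmetic genus is $p_a(C)=n+1$. $Bin_{p_a(C)}\subset\overline{\mathcal{M}}_{p_a(C)}$ denotes the locus of binary curves in the moduli space of stable curves of genus $p_a(C)$; a general binary curve is a binary curve $C$ with $[C]$ general in $Bin_{p_a(C)}$ (i.e. in a suitable dense open subset). For $p_a(C)\geq 3$ a general binary curve is not hyperelliptic (it has no finite degree-$2$ morphism to $\mathbb{P}^1$), so its canonical system $|K_C|$ embeds it in $\mathbb{P}^n$ as the union of two rational normal curves of degree $n$ meeting in $n+2$ distinct points in linear general position (every subset of at most $n+1$ of them is linearly independent), and $C$ is identified with this image. In these terms, $C$ is a general binary curve if and only if $\Gamma_1,\Gamma_2$ are general rational normal curves passing through the $n+2$ points $\Gamma_1\cap\Gamma_2$. A rational normal scroll of dimension $d$ and minimal degree $n-d+1$ in $\mathbb{P}^n$ is the (possibly singular) birational image of $\mathbb{F}(a_1,\dots,a_d)=\mathbb{P}(\bigoplus_{i=1}^d\mathcal{O}_{\mathbb{P}^1}(a_i))$, with $a_i\ge0$, some $a_i>0$, and $\sum a_i=n-d+1$,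 under the morphism to $\mathbb{P}^n$ given by the complete linear system $|M|$. Here $M$ is the relative hyperplane class, characterised by the property that, with fibre coordinates $(y_1,\dots,y_d)$ and $L$ the pullback of $\mathcal{O}_{\mathbb{P}^1}(1)$, the divisor $(y_i=0)$ lies in $|M-a_iL|$. *)

(* Defs.v *)
(* Conventions.  A point of P^m over K is represented by a nonzero row vector
   x : 'rV[K]_m.+1, and x, y represent the same point iff (x == y)%MS (equal
   lines).  A subset of P^m is given by the set of representatives of its
   points.  A tuple of points of P^1 is a matrix whose rows represent them. *)
From HB Require Import structures.
From mathcomp Require Export all_boot all_order all_algebra all_fingroup.
From mathcomp Require Export boolp classical_sets reals complex mpoly.

Set Implicit Arguments.
Unset Strict Implicit.
Unset Printing Implicit Defensive.

Export Order.TTheory GRing.Theory Num.Theory.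

Local Open Scope classical_set_scope.
Local Open Scope ring_scope.

Section Defs.
Variable K : fieldType.

(* The monomials of degree a at t; a binary form of degree a is given by the
   column F of its coefficients, and its value at t is veronese a t *m F. *)
Definition veronese (a : nat) (t : 'rV[K]_2) : 'rV[K]_a.+1 :=
  \row_(j < a.+1) (t 0 0 ^+ (a - j) * t 0 1 ^+ j).

Definition form_eval (a : nat) (F : 'cV[K]_a.+1) (t : 'rV[K]_2) : K :=
  (veronese a t *m F) 0 0.

Definition proj_image (T : Type) (m : nat) (D : set T) (phi : T -> 'rV[K]_m) :
  set 'rV[K]_m := [set x | x != 0 /\ exists2 t, D t & (x == phi t)%MS].

Section BinaryCurves.
Variable n : nat.

(* The pair (P, Q) stands for the curve obtained from two copies of P^1 by
   gluing the i-th point of P to the i-th point of Q into a node, for each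
   i < n + 2.  Every binary curve of arithmetic genus n + 1 arises so. *)
Definition gluing : Type := ('M[K]_(n.+2, 2) * 'M[K]_(n.+2, 2))%type.

Definition distinct_points (P : 'M[K]_(n.+2, 2)) : Prop :=
  (forall i, row i P != 0) /\
  (forall i j, i != j -> ~~ (row i P == row j P)%MS).

Definition binary_curve (g : gluing) : Prop :=
  distinct_points g.1 /\ distinct_points g.2.

Definition proj_equiv (s : 'S_n.+2) (P P' : 'M[K]_(n.+2, 2)) : Prop :=
  exists2 M : 'M[K]_2, M \in unitmx &
    forall i, (row i P *m M == row (s i) P')%MS.

(* An isomorphism permutes the nodes and may exchange the two components. *)
Definition binary_iso (g h : gluing) : Prop :=
  exists s : 'S_n.+2,
    (proj_equiv s g.1 h.1 /\ proj_equiv s g.2 h.2) \/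
    (proj_equiv s g.1 h.2 /\ proj_equiv s g.2 h.1).

Definition coords (g : gluing) : 'I_(n.+2 * (2 + 2)) -> K :=
  fun k => mxvec (row_mx g.1 g.2) 0 k.

(* A subset of the locus Bin of binary curves is an isomorphism-invariant
   property of gluings.  Bin carries the quotient topology of the space of
   gluings, because M_{0,n+2} x M_{0,n+2} -> Bin is finite and surjective, and
   M_{0,n+2} is the quotient by PGL_2 of the tuples of distinct points.  A
   subset of a product of P^1's is Zariski open iff the set of its
   representatives is the non-vanishing locus of a family of polynomials. *)
Definition bin_open (U : set gluing) : Prop :=
  (forall g h, binary_curve g -> binary_curve h -> binary_iso g h ->
     U g -> U h) /\
  exists E : set {mpoly K[n.+2 * (2 + 2)]},
    forall g, binary_curve g ->
      (U g <-> exists2 f, E f & f.@[coords g] != 0).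

Definition bin_dense (U : set gluing) : Prop :=
  forall V, bin_open V -> (exists2 g, binary_curve g & V g) ->
    exists2 g, binary_curve g & U g /\ V g.

Definition for_general_binary_curve (p : gluing -> Prop) : Prop :=
  exists U : set gluing, [/\ bin_open U, bin_dense U &
    forall g, binary_curve g -> U g -> p g].

Definition bracket (u v : 'rV[K]_2) : K := u 0 0 * v 0 1 - u 0 1 * v 0 0.

(* The differentials on P^1 with at most simple poles at the points p_j of P
   are F(t) (t0 dt1 - t1 dt0) / prod_j [t, p_j] with F a form of degree n.
   At t = p_i + z w with [p_i, w] = 1 one has t0 dt1 - t1 dt0 = dz and
   [t, p_i] = - z, whence the residue at p_i. *)
Definition residue (P : 'M[K]_(n.+2, 2)) (F : 'cV[K]_n.+1) (i : 'I_n.+2) : K :=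
  - (form_eval F (row i P) /
     \prod_(j < n.+2 | j != i) bracket (row i P) (row j P)).

(* Sections of the dualizing sheaf of a nodal curve: differentials on the
   normalization with at most simple poles over the nodes and opposite residues
   at the two points over each node. *)
Definition canonical_section (g : gluing) (F G : 'cV[K]_n.+1) : Prop :=
  forall i, residue g.1 F i + residue g.2 G i = 0.

(* The pairs (col k A, col k B), k < n + 1, form a basis of H^0(C, K_C). *)
Definition canonical_basis (g : gluing) (A B : 'M[K]_n.+1) : Prop :=
  row_full (col_mx A B) /\
  forall F G : 'cV[K]_n.+1,
    canonical_section g F G <-> exists c : 'cV[K]_n.+1, F = A *m c /\ G = B *m c.

(* Image of one component under the map given by the columns of A.  For a
   canonical basis (A, B), a section vanishing on one component is a form of
   degree n with n + 2 zeros on the other, so A and B are invertible and the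
   images are rational normal curves; they meet in exactly n + 2 points when
   the curve is general (not hyperelliptic). *)
Definition rational_curve (A : 'M[K]_n.+1) : set 'rV[K]_n.+1 :=
  proj_image [set t | t != 0] (fun t => veronese n t *m A).

Definition canonical_curve (A B : 'M[K]_n.+1) : set 'rV[K]_n.+1 :=
  rational_curve A `|` rational_curve B.

End BinaryCurves.

(* F(a_1, ..., a_d) is the set of (t, y) with t, y nonzero, modulo
   (t, y) ~ (l t, (l^-a_i y_i)_i) and (t, y) ~ (t, m y).  As (y_i = 0) lies in
   |M - a_i L|, H^0(M) has basis the products of y_i with the monomials of
   degree a_i in t: these are the entries of the \mxrow below. *)
Definition scroll_map (d : nat) (a : 'I_d -> nat) (m : nat)
    (B : 'M[K]_(\sum_(i < d) (a i).+1, m)) (ty : 'rV[K]_2 * 'rV[K]_d) :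
    'rV[K]_m :=
  (\mxrow_(i < d) (ty.2 0 i *: veronese (a i) ty.1)) *m B.

(* B changes the monomial basis of H^0(M) into an arbitrary one. *)
Definition rational_normal_scroll (n d : nat) (S : set 'rV[K]_n.+1) : Prop :=
  exists (a : 'I_d -> nat) (B : 'M[K]_(\sum_(i < d) (a i).+1, n.+1)),
    [/\ (exists i, 0 < a i)%N, (\sum_(i < d) a i + d = n.+1)%N,
        row_free B /\ row_full B &
        S = proj_image [set ty | ty.1 != 0 /\ ty.2 != 0] (scroll_map B)].

End Defs.

(* Main.v *)
(* Let m = floor(n/2) + 1.  On each component, the ruling of a scroll containing
   C cuts out a pencil, and the 2 x (n + 1 - d) matrix of linear forms defining
   the scroll restricts to a rank-one matrix: x_w = s_0 h_w, y_w = s_1 h_w.  The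
   n + 1 - d pairs (h_w, h'_w) are sections of K - D; by Riemann-Roch, here a
   rank count combined with the residue theorem on each component, they yield
   two sections (sigma, sigma'), (tau, tau') of bidegree (p, q), p + q = m, and

     Phi = sigma (x) tau' - tau (x) sigma'

   is a nonzero form of bidegree (p, q) and rank at most 2 on P^1 x P^1 that
   vanishes at the n + 2 pairs (P_i, Q_i) of points lying over the nodes.

   For general nodes there is no such form.  By elimination (a determinant
   instead of a resultant) the nodes admitting one satisfy a polynomial equation
   that fails at any particular configuration for which no such form exists over
   any extension field, and the nodes (j, j), j <= m, and (j, j + 1), j < m - 1,
   are one: there sigma/tau = sigma'/tau' is a rational function invariant under
   x |-> x + 1, hence constant, so Phi = 0. *)

(* The value of m is squeezed from both sides: with n + 1 - d columns the rank count needs m >= d +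
   1, while the special nodes number 2m, so 2m <= n + 2. The bound d <= n/2 makes both hold for m =
   floor(n/2) + 1.

   The degrees k1, k2 of the two pencils are not under control. The sections of K - D are used when
   k1 + k2 >= m. For smaller k1 + k2, pencils that agree at all nodes give Phi directly; they can
   disagree at a node only if all columns vanish there, and moving this zero into one pencil raises
   its degree until one of the two cases applies.

   Common zeros over extension fields are tested in residue fields of prime ideals, which contain
   the base field and so keep characteristic 0.

   The special nodes may repeat points on a component, so they need not form a binary curve. Hence
   the equation lives on all pairs of matrices, and a line through the special configuration carries
   its non-vanishing over to binary curves. It need not be invariant under isomorphism either, so
   the open set is the complement of the closure of the whole bad locus. *)
From HB Require Import structures.
From mathcomp Require Import ring_quotient fraction generic_quotient.
From mathcomp Require Import zify ring.
Require Import Defs.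

Set Implicit Arguments.
Unset Strict Implicit.
Unset Printing Implicit Defensive.

Local Open Scope classical_set_scope.
Local Open Scope ring_scope.
Local Open Scope quotient_scope.

(** * Prime ideals and nilpotence *)

Section PrimeQuotient.
Variables (S : comNzRingType) (I : prime_idealr S).

Definition prime_quot : Type := Quotient.quot I.
HB.instance Definition _ := GRing.ComNzRing.on prime_quot.

(** Units and inverses are chosen classically: the fraction field is built over an integral domain
    that carries a unit structure. *)
Definition prime_quot_unit : pred prime_quot :=
  fun x => `[< exists y, y * x = 1 >].
Definition prime_quot_inv (x : prime_quot) : prime_quot :=
  if pselect (exists y, y * x = 1) is left e then sval (cid e) else x.

Lemma prime_quot_mulVr : {in prime_quot_unit, left_inverse 1 prime_quot_inv *%R}.
Proof.
move=> x /asboolP xu; rewrite /prime_quot_inv; case: pselect => // e.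
by case: cid.
Qed.

Lemma prime_quot_unitP (x y : prime_quot) : y * x = 1 -> prime_quot_unit x.
Proof. by move=> yx; apply/asboolP; exists y. Qed.

Lemma prime_quot_inv_out : {in [predC prime_quot_unit], prime_quot_inv =1 id}.
Proof.
by move=> x /asboolPn xn; rewrite /prime_quot_inv; case: pselect.
Qed.

HB.instance Definition _ := GRing.ComNzRing_hasMulInverse.Build prime_quot
  prime_quot_mulVr prime_quot_unitP prime_quot_inv_out.

HB.instance Definition _ := GRing.ComUnitRing_isIntegral.Build prime_quot
  (@Quotient.rquot_IdomainAxiom S I).

Lemma prime_residue :
  exists phi : {rmorphism S -> {fraction prime_quot}},
    forall x, (phi x == 0) = (x \in I).
Proof.
pose pi : {rmorphism S -> prime_quot} := \pi_(Quotient.quot I).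
exists (@tofrac prime_quot \o pi : {rmorphism S -> {fraction prime_quot}}).
move=> x; rewrite /= tofrac_eq0 -[in RHS](subr0 x) Quotient.idealrBE.
by rewrite -(rmorph0 pi).
Qed.

End PrimeQuotient.

Section Krull.
Variable S : comNzRingType.

Definition is_ideal (J : set S) :=
  [/\ J 0, forall x y, J x -> J y -> J (x + y) & forall a x, J x -> J (a * x)].

(** An ideal maximal among those containing [J] and missing all powers of [a] is prime, and the map
    to its residue field kills [J] but not [a]. *)
Lemma nilpotent_mod_ideal (J : set S) (a : S) : is_ideal J ->
  (forall (F : fieldType) (phi : {rmorphism S -> F}),
     (forall x, J x -> phi x = 0) -> phi a = 0) ->
  exists D, J (a ^+ D).
Proof.
move=> Jid hphi; apply: contrapT => /forallNP aJ.
pose P (X : set S) := X = set0 \/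
  [/\ is_ideal X, J `<=` X & forall D, ~ X (a ^+ D)].
have [|A [PA Amax]] := @Zorn_bigcup S P.
  move=> F FP Ftot.
  have [[X0 FX0 /eqP/set0P X0n0]|nF] := pselect (exists2 X, F X & X <> set0);
    last first.
    left; apply/seteqP; split=> // x [X FX Xx]; apply: nF; exists X => //.
    by move=> XE; rewrite XE in Xx.
  right.
  have FPn0 X : F X -> forall x, X x ->
      [/\ is_ideal X, J `<=` X & forall D, ~ X (a ^+ D)].
    by move=> FX x Xx; case: (FP _ FX) => // XE; rewrite XE in Xx.
  have [x0 Xx0] := X0n0; have [[X00 _ _] JX0 _] := FPn0 _ FX0 _ Xx0.
  split; first split.
  - by exists X0.
  - move=> x y [X FX Xx] [Y FY Yy]; case: (Ftot _ _ FX FY) => [XY|YX].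
      by exists Y => //; have [[_ YD _] _ _] := FPn0 _ FY _ Yy; apply/YD/Yy/XY.
    by exists X => //; have [[_ XD _] _ _] := FPn0 _ FX _ Xx; apply/XD => //; apply: YX.
  - move=> b x [X FX Xx]; exists X => //.
    by have [[_ _ XM] _ _] := FPn0 _ FX _ Xx; apply: XM.
  - by move=> x Jx; exists X0 => //; apply: JX0.
  - by move=> D [X FX XaD]; have [_ _ /(_ D)] := FPn0 _ FX _ XaD.
have {PA}[Aid JA aA] : [/\ is_ideal A, J `<=` A & forall D, ~ A (a ^+ D)].
  case: PA => // A0; case: (Amax J); last by right; split.
  rewrite A0; split; first exact: sub0set.
  by move=> /(_ 0) h; apply: h; case: Jid.
have [A0 AD AM] := Aid.
(* By maximality [A + (x)] contains a power of [a]. Multiplying two such powers shows that [A] is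
   prime. *)
have ext x : ~ A x -> exists D b, exists2 c, A c & a ^+ D = c + b * x.
  move=> nAx; pose B := [set y | exists b, exists2 c, A c & y = c + b * x].
  have AB : A `<=` B by move=> y Ay; exists 0, y => //; rewrite mul0r addr0.
  have Bx : B x by exists 1, 0 => //; rewrite mul1r add0r.
  apply: contrapT => nex; apply: (Amax B); first by split=> // /(_ _ Bx).
  right; split; last 2 first.
  - by apply: subset_trans AB.
  - by move=> D [b [c Ac e]]; apply: nex; exists D, b, c.
  split; first exact: AB.
  - move=> y z [b [c Ac ->]] [b' [c' Ac' ->]]; exists (b + b'), (c + c').
      exact: AD.
    by ring.
  - move=> e y [b [c Ac ->]]; exists (e * b), (e * c); first exact: AM.
    by ring.
pose I : S -> bool := fun x => `[< A x >].
have Iid : idealr_closed I.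
  split; first exact/asboolP.
    by apply/asboolPn => A1; apply: (aA 0); rewrite expr0.
  by move=> b x y /asboolP Ax /asboolP Ay; apply/asboolP/AD => //; apply: AM.
have Ipr : prime_idealr_closed I.
  move=> x y /asboolP Axy; apply: contrapT => /negP; rewrite negb_or.
  move=> /andP[/asboolPn/ext[D [b [c Ac e]]] /asboolPn/ext[D' [b' [c' Ac' e']]]].
  apply: (aA (D + D')%N); rewrite exprD e e'.
  have -> : (c + b * x) * (c' + b' * y) =
            (c' + b' * y) * c + ((b * x) * c' + b * b' * (x * y)) by ring.
  by apply: (AD); [apply: (AM)|apply: AD; apply: AM].
pose pI1 := isIdealr.Build S I Iid.
pose pI2 := isPrimeIdealrClosed.Build S I Ipr.
pose PI : prime_idealr S := HB.pack I pI1 pI2.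
have [phi phiP] := prime_residue PI.
have : phi a = 0.
  by apply: hphi => x Jx; apply/eqP; rewrite phiP; apply/asboolP/JA.
by move/eqP; rewrite phiP => /asboolP Aa; apply: (aA 1); rewrite expr1.
Qed.

End Krull.

(** * Forms of rank 2 on a shifted diagonal *)

Lemma rank_factor (F : fieldType) (p q r : nat) (A : 'M[F]_(p, q)) :
  (\rank A <= r)%N -> exists (L : 'M_(p, r)) (R : 'M_(r, q)), A = L *m R.
Proof.
move=> rA; exists (col_base A *m pid_mx (\rank A)), (pid_mx (\rank A) *m row_base A).
rewrite mulmxA -(mulmxA (col_base A)) mul_pid_mx minnn (minn_idPr rA).
by rewrite pid_mx_1 mulmx1 mulmx_base.
Qed.

Lemma coprime_factor (F : fieldType) (s t : {poly F}) : (s != 0) || (t != 0) ->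
  exists g a b, [/\ g != 0, s = g * a, t = g * b & coprimep a b].
Proof.
move=> st0; exists (gcdp s t), (s %/ gcdp s t), (t %/ gcdp s t); split.
- by rewrite gcdp_eq0 negb_and.
- by rewrite mulrC divpK ?dvdp_gcdl.
- by rewrite mulrC divpK ?dvdp_gcdr.
- exact: coprimep_div_gcd.
Qed.

Section ShiftedDiagonal.
Variables (F : fieldType) (natF_inj : injective (fun i : nat => i%:R : F)).
Implicit Types s t : {poly F}.

Lemma poly_nat_roots_eq0 s k : (size s <= k)%N ->
  (forall i, (i < k)%N -> s.[i%:R] = 0) -> s = 0.
Proof.
move=> sk s0; apply/eqP/negP => /negP sn0.
have := @max_poly_roots _ s [seq i%:R | i <- iota 0 k] sn0.
rewrite size_map size_iota map_inj_uniq // iota_uniq => /(_ _ isT).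
rewrite ltnNge sk => h; suff: false by []; apply: h.
by apply/allP => x /mapP[j]; rewrite mem_iota /= add0n => jk ->; exact/eqP/s0.
Qed.

(** The difference [s - s(0)] vanishes at all natural numbers, which are distinct in [F]. *)
Lemma shift_invariant_const s : s \Po ('X + 1) = s -> s = (s.[0])%:P.
Proof.
move=> ss; apply/eqP; rewrite -subr_eq0; apply/eqP.
apply: (poly_nat_roots_eq0 (leqnn _)) => i _.
rewrite hornerD hornerN hornerC; apply/eqP; rewrite subr_eq0; apply/eqP.
elim: i => // i IH; rewrite -IH -{2}ss horner_comp.
by rewrite hornerD hornerX hornerC -natr1.
Qed.

Local Notation shift s := (s \Po ('X + 1)).

Lemma size_X1 : size ('X + 1 : {poly F}) = 2.
Proof. by rewrite -polyC1 size_XaddC. Qed.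

(** A polynomial and its shift have the same degree and leading coefficient, so divisibility is
    equality. *)
Lemma dvdp_shift_const s : s != 0 -> s %| shift s -> s = (s.[0])%:P.
Proof.
move=> s0 sd; apply: shift_invariant_const.
have := dvdp_size_eqp sd; rewrite size_comp_poly2 ?size_X1 // eqxx => /esym.
move=> /eqp_eq; rewrite lead_coef_comp ?size_X1 // -polyC1 lead_coefXaddC.
by rewrite expr1n mulr1 => /esym; apply: scalerI; rewrite lead_coef_eq0.
Qed.

(** In lowest terms, numerator and denominator of s / t each divide their own shift, hence are
    constant. *)
Lemma proportional_of_shift (s t : {poly F}) : s * shift t = t * shift s ->
  exists (r : {poly F}) (c d : F), s = c *: r /\ t = d *: r.
Proof.
have [->|sn0] := eqVneq s 0; first by exists t, 0, 1; rewrite scale0r scale1r.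
have [->|tn0] := eqVneq t 0; first by exists s, 1, 0; rewrite scale0r scale1r.
have [|g [a [b [g0 sE tE cab]]]] := @coprime_factor _ s t; first by rewrite sn0.
rewrite {}sE {}tE in sn0 tn0 *; rewrite !comp_polyM => e.
move: sn0 tn0; rewrite !mulf_eq0 !negb_or => /andP[_ a0] /andP[_ b0].
have {}e : a * shift b = b * shift a.
  have gg : g * shift g != 0 by rewrite mulf_neq0 ?comp_poly2_eq0 ?size_X1.
  by apply: (mulfI gg); rewrite mulrACA e mulrACA.
have aC : a = (a.[0])%:P.
  apply: dvdp_shift_const => //; rewrite -(Gauss_dvdpr _ cab) -e.
  exact: dvdp_mulr.
have bC : b = (b.[0])%:P.
  apply: dvdp_shift_const => //; rewrite coprimep_sym in cab.
  by rewrite -(Gauss_dvdpr _ cab) e dvdp_mulr.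
by exists g, a.[0], b.[0]; rewrite -!mul_polyC -aC -bC mulrC (mulrC b).
Qed.

(** The form of [A], dehomogenized and restricted to the graph of [y]. *)
Definition bipoly p q (A : 'M[F]_(p.+1, q.+1)) (y : {poly F}) : {poly F} :=
  \sum_a \sum_b A a b *: ('X^a * y ^+ b).

Lemma size_shift_expB k : (size (('X + 1) ^+ k - 'X^k : {poly F})%R <= k)%N.
Proof.
elim: k => [|k IH]; first by rewrite !expr0 subrr size_poly0.
have -> : (('X + 1) ^+ k.+1 - 'X^(k.+1) : {poly F}) =
    (('X + 1) ^+ k - 'X^k) * ('X + 1) + 'X^k.
  by rewrite !exprSr; ring.
apply: leq_trans (size_polyD _ _) _; rewrite geq_max size_polyXn leqnn andbT.
by apply: leq_trans (size_polyMleq _ _) _; rewrite size_X1 addn2.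
Qed.

Lemma size_bipolyX p q (A : 'M[F]_(p.+1, q.+1)) :
  (size (bipoly A 'X) <= (p + q).+1)%N.
Proof.
apply: leq_trans (size_sum _ _ _) _; apply/bigmax_leqP => a _.
apply: leq_trans (size_sum _ _ _) _; apply/bigmax_leqP => b _.
apply: leq_trans (size_scale_leq _ _) _; rewrite -exprD size_polyXn ltnS.
by rewrite leq_add -1?ltnS.
Qed.

Lemma coef_bipolyX p q (A : 'M[F]_(p.+1, q.+1)) :
  (bipoly A 'X)`_(p + q) = A ord_max ord_max.
Proof.
rewrite /bipoly coef_sum big_ord_recr /= big1 => [|a _]; last first.
  rewrite coef_sum big1 // => b _; rewrite coefZ -exprD coefXn.
  by rewrite gtn_eqF ?mulr0 //; have := ltn_ord a; have := ltn_ord b; lia.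
rewrite add0r coef_sum big_ord_recr /= big1 => [|b _]; last first.
  rewrite coefZ -exprD coefXn.
  by rewrite gtn_eqF ?mulr0 //; have := ltn_ord b; lia.
by rewrite add0r coefZ -exprD coefXn eqxx mulr1.
Qed.

(** The curves y = x and y = x + 1 are tangent at (infinity, infinity). A form vanishing on the
    first thus has a double zero there on the second, and p + q - 1 further zeros suffice instead of
    p + q + 1. *)
Lemma size_bipoly_shift p q (A : 'M[F]_(p.+1, q.+1)) :
  A ord_max ord_max = 0 ->
  (size (bipoly A ('X + 1) - bipoly A 'X)%R <= (p + q).-1)%N.
Proof.
move=> A0; rewrite /bipoly -sumrB.
apply: leq_trans (size_sum _ _ _) _; apply/bigmax_leqP => a _; rewrite -sumrB.
apply: leq_trans (size_sum _ _ _) _; apply/bigmax_leqP => b _.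
rewrite -scalerBr -mulrBr.
have [/andP[/eqP-> /eqP->]|ab] := boolP ((a == ord_max) && (b == ord_max)).
  by rewrite A0 scale0r size_poly0.
apply: leq_trans (size_scale_leq _ _) _.
apply: leq_trans (size_polyMleq _ _) _; rewrite size_polyXn.
have := size_shift_expB b; have := ltn_ord a; have := ltn_ord b.
rewrite -!val_eqE /= negb_and in ab; set z := size _.
by case/orP: ab => /eqP; lia.
Qed.

Lemma horner_bipoly p q (A : 'M[F]_(p.+1, q.+1)) y x :
  (bipoly A y).[x] = \sum_a \sum_b A a b * (x ^+ a * y.[x] ^+ b).
Proof.
rewrite horner_sum; apply: eq_bigr => a _; rewrite horner_sum.
by apply: eq_bigr => b _; rewrite hornerZ hornerM hornerXn horner_exp.
Qed.

(* A = L R with two inner indices, so that the bihomogeneous form of A is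
   s_0(x) t_0(y) + s_1(x) t_1(y).  As it vanishes on y = x and on y = x + 1,
   (t_0 : t_1) is invariant under the shift, hence constant. *)
Lemma bipoly_rank2_eq0 p q (A : 'M[F]_(p.+1, q.+1)) : (\rank A <= 2)%N ->
  bipoly A 'X = 0 -> bipoly A ('X + 1) = 0 -> A = 0.
Proof.
move=> /rank_factor[L [R AE]].
pose s l := \poly_(a < p.+1) L (inord a) l.
pose t l := \poly_(b < q.+1) R l (inord b).
have bE y : bipoly A y = s 0 * (t 0 \Po y) + s 1 * (t 1 \Po y).
  have -> : s 0 * (t 0 \Po y) + s 1 * (t 1 \Po y) =
      \sum_(l < 2) s l * (t l \Po y).
    by rewrite big_ord_recl big_ord1; congr (_ + s _ * (t _ \Po y)); apply: val_inj.
  have sE l : s l = \sum_(a < p.+1) L a l *: 'X^a.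
    by rewrite /s poly_def; apply: eq_bigr => a _; rewrite inord_val.
  have tE l : t l \Po y = \sum_(b < q.+1) R l b *: y ^+ b.
    rewrite /t poly_def raddf_sum; apply: eq_bigr => b _.
    by rewrite inord_val /= comp_polyZ comp_Xn_poly.
  under [RHS]eq_bigr do rewrite sE tE big_distrlr /=.
  rewrite exchange_big; apply: eq_bigr => a _ /=.
  rewrite exchange_big; apply: eq_bigr => b _ /=.
  rewrite AE mxE scaler_suml; apply: eq_bigr => l _.
  by rewrite -scalerAl -scalerAr scalerA.
rewrite !bE !comp_polyXr => e1 e2.
have AE' a b : A a b = (s 0)`_a * (t 0)`_b + (s 1)`_a * (t 1)`_b.
  rewrite AE mxE big_ord_recl big_ord1 !coef_poly !ltn_ord !inord_val.
  by congr (_ + L a _ * R _ b); apply: val_inj.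
have [/andP[/eqP s0 /eqP s1]|sn0] := boolP ((s 0 == 0) && (s 1 == 0)).
  by apply/matrixP => a b; rewrite AE' s0 s1 !coef0 !mul0r addr0 mxE.
have tsh : t 0 * (t 1 \Po ('X + 1)) = t 1 * (t 0 \Po ('X + 1)).
  apply/eqP; rewrite -subr_eq0; move: sn0; rewrite negb_and => /orP[] sn0.
    rewrite -(mulrI_eq0 _ (mulfI sn0)); apply/eqP.
    transitivity ((s 0 * t 0 + s 1 * t 1) * (t 1 \Po ('X + 1))
      - t 1 * (s 0 * (t 0 \Po ('X + 1)) + s 1 * (t 1 \Po ('X + 1)))); first by ring.
    by rewrite e1 e2; ring.
  rewrite -(mulrI_eq0 _ (mulfI sn0)); apply/eqP.
  transitivity (t 0 * (s 0 * (t 0 \Po ('X + 1)) + s 1 * (t 1 \Po ('X + 1)))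
    - (s 0 * t 0 + s 1 * t 1) * (t 0 \Po ('X + 1))); first by ring.
  by rewrite e1 e2; ring.
have [r [c [d [t0E t1E]]]] := proportional_of_shift tsh.
have /eqP : (c *: s 0 + d *: s 1) * r = 0.
  by rewrite -e1 t0E t1E -!mul_polyC; ring.
(* [A] is now an outer product, one factor of which is zero. *)
have AE2 a b : A a b = (c *: s 0 + d *: s 1)`_a * r`_b.
  by rewrite AE' t0E t1E coefD !coefZ; ring.
rewrite mulf_eq0 => /orP[] /eqP h; apply/matrixP => a b; rewrite AE2 h coef0 mxE.
  by rewrite mul0r.
by rewrite mulr0.
Qed.

Lemma rank2_eq0 p q (A : 'M[F]_(p.+1, q.+1)) : (\rank A <= 2)%N ->
  (forall j, (j <= p + q)%N ->
     \sum_a \sum_b A a b * (j%:R ^+ a * j%:R ^+ b) = 0) ->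
  (forall j, (j < (p + q).-1)%N ->
     \sum_a \sum_b A a b * (j%:R ^+ a * j.+1%:R ^+ b) = 0) ->
  A = 0.
Proof.
move=> rA e1 e2.
have B0 : bipoly A 'X = 0.
  apply: (poly_nat_roots_eq0 (size_bipolyX A)) => j jpq.
  by rewrite horner_bipoly hornerX e1.
apply: (bipoly_rank2_eq0 rA B0).
have A0 : A ord_max ord_max = 0 by rewrite -coef_bipolyX B0 coef0.
have := size_bipoly_shift A0; rewrite B0 subr0 => sz.
apply: (poly_nat_roots_eq0 sz) => j jpq.
by rewrite horner_bipoly hornerD hornerX hornerC natr1 e2.
Qed.

End ShiftedDiagonal.

(** * Elimination *)

Section Words.
Variables (K : fieldType) (C : finType).
Local Notation S := {mpoly K[#|C|]}.

(** Words replace monomials because a nonempty word splits canonically into a first letter and a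
    tail; this split indexes the linear system below. *)
Definition word_value (v : C -> K) (w : seq C) : K := \prod_(c <- w) v c.

Definition monomial_word (m : 'X_{1..#|C|}) : seq C :=
  flatten [seq nseq (m k) (enum_val k) | k <- enum 'I_#|C|].

Lemma size_monomial_word m : size (monomial_word m) = mdeg m.
Proof.
rewrite size_flatten /shape -map_comp sumnE big_map big_enum mdegE.
by apply: eq_bigr => k _; rewrite /= size_nseq.
Qed.

Lemma word_value_monomial v m :
  word_value v (monomial_word m) = \prod_k v (enum_val k) ^+ m k.
Proof.
rewrite /word_value big_flatten big_map big_enum; apply: eq_bigr => k _ /=.
by rewrite big_nseq iter_mulr_1.
Qed.

(* Evaluation at v, graded by the total degree. *)
Definition graded_eval (v : C -> K) : S -> {poly K} :=
  mmap polyC (fun k => v (enum_val k) *: 'X).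

HB.instance Definition _ v := GRing.RMorphism.copy (graded_eval v)
  (mmap polyC (fun k => v (enum_val k) *: 'X)).

Definition letter (c : C) : S := 'X_(enum_rank c).

Lemma graded_eval_letter v c : graded_eval v (letter c) = v c *: 'X.
Proof. by rewrite /graded_eval mmapX mmap1U enum_rankK. Qed.

Lemma graded_eval_word v w :
  graded_eval v (\prod_(c <- w) letter c) = word_value v w *: 'X^(size w).
Proof.
rewrite rmorph_prod /= /word_value; elim: w => [|c w IH].
  by rewrite !big_nil scale1r expr0.
rewrite !big_cons IH graded_eval_letter -!mul_polyC polyCM /= exprS; ring.
Qed.

(** The coefficients do not depend on [v]. A monomial has several spellings; all its weight is put
    on [monomial_word]. *)
Lemma coef_graded_eval (s : S) : exists rho : forall d, d.-tuple C -> K,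
  forall v d, (graded_eval v s)`_d = \sum_(w : d.-tuple C) rho d w * word_value v w.
Proof.
exists (fun d w => \sum_(m <- msupp s) s@_m * (tval w == monomial_word m)%:R).
move=> v d; rewrite /graded_eval /mmap coef_sum.
under [RHS]eq_bigr do rewrite mulr_suml.
rewrite exchange_big /=; apply: eq_bigr => m _.
have -> : mmap1 (fun k => v (enum_val k) *: 'X) m =
    word_value v (monomial_word m) *: 'X^(mdeg m).
  rewrite word_value_monomial /mmap1 mdegE -mul_polyC rmorph_prod expr_sum.
  rewrite -big_split; apply: eq_bigr => k _.
  by rewrite /= -mul_polyC exprMn rmorphXn.
rewrite coefCM coefZ coefXn -size_monomial_word.
under eq_bigr do rewrite -mulrA; rewrite -mulr_sumr; congr (_ * _).
have [->|ne] := eqVneq d (size (monomial_word m)).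
  rewrite mulr1 (bigD1 (in_tuple (monomial_word m))) //= eqxx mul1r.
  rewrite big1 ?addr0 // => w /negbTE.
  by rewrite -val_eqE /= => ->; rewrite mul0r.
rewrite mulr0 big1 // => w _; case: eqP => [e|_]; last by rewrite mul0r.
by rewrite -e size_tuple eqxx in ne.
Qed.

Lemma pigeonhole_word (w : seq C) D : (#|C| * D < size w)%N ->
  exists c, (D < count_mem c w)%N.
Proof.
have -> : size w = (\sum_c count_mem c w)%N.
  elim: w => [|c w IH] /=; first by rewrite big1.
  rewrite big_split /= -IH (bigD1 c) //= eqxx big1 => [|c' /negbTE cc'].
    by rewrite addn0.
  by rewrite eq_sym cc'.
move=> h; apply/existsP; apply: contraLR h; rewrite negb_exists -leqNgt.
move=> /forallP h; rewrite -sum_nat_const; apply: leq_sum => c _.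
by rewrite leqNgt h.
Qed.

End Words.

(* If the linear forms eta i have no common zero on the cone X over any field,
   the words of some length lie in the ideal they generate modulo the equations
   of X.  Perturbing eta to eta' turns this into a linear system v = M v for the
   vector v of values of these words at a common zero of the eta' i, whose
   matrix M depends polynomially on eta' and vanishes at eta. *)
Section Elimination.
Variables (K : fieldType) (C : finType) (N : nat).
Variables (X : set (C -> K)) (eta : 'I_N -> C -> K).
Local Notation S := {mpoly K[#|C|]}.

Hypothesis no_zero : forall (F : fieldType) (phi : {rmorphism S -> F}),
  (forall s, (forall v, X v -> graded_eval v s = 0) -> phi s = 0) ->
  (forall i, \sum_c phi (eta i c)%:MP * phi (letter K c) = 0) ->
  forall c, phi (letter K c) = 0.

Let lin (e : 'I_N -> C -> K) i v := \sum_c e i c * v c.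

(** The cofactors [r] serve all points of [X] at once, so that the final matrix does not depend on
    the point. *)
Let J : set S := [set s | exists r : 'I_N -> S, forall v, X v ->
  graded_eval v s = \sum_i (lin eta i v *: 'X) * graded_eval v (r i)].

Let J_ideal : is_ideal J.
Proof.
split.
- by exists (fun=> 0) => v _; rewrite [LHS]rmorph0 big1 // => i _; rewrite rmorph0 mulr0.
- move=> s t [r rE] [q qE]; exists (fun i => r i + q i) => v Xv.
  rewrite rmorphD /= rE // qE // -big_split /=; apply: eq_bigr => i _.
  by rewrite rmorphD mulrDr.
- move=> a s [r rE]; exists (fun i => a * r i) => v Xv.
  rewrite rmorphM /= rE // mulr_sumr /=; apply: eq_bigr => i _.
  by rewrite rmorphM; ring.
Qed.

Let letter_nilpotent : exists D, forall c, J (letter K c ^+ D).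
Proof.
have h c : exists D, J (letter K c ^+ D).
  apply: nilpotent_mod_ideal => // F phi phiJ; apply: no_zero.
    move=> s s0; apply: phiJ; exists (fun=> 0) => v Xv.
    by rewrite s0 // big1 // => i _; rewrite rmorph0 mulr0.
  move=> i; under eq_bigr do rewrite -rmorphM.
  rewrite -rmorph_sum; apply: phiJ; exists (fun j => (j == i)%:R) => v Xv.
  rewrite (bigD1 i) //= eqxx rmorph1 mulr1 [X in _ = _ + X]big1; last first.
    by move=> j ji; rewrite (negbTE ji) rmorph0 mulr0.
  rewrite addr0 rmorph_sum /lin scaler_suml; apply: eq_bigr => c' _.
  by rewrite rmorphM /= graded_eval_letter /graded_eval mmapC mul_polyC scalerA.
have [D DP] := choice h; exists (\max_c D c) => c.
have /subnK <- : (D c <= \max_c D c)%N by apply: leq_bigmax.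
by rewrite exprD; case: J_ideal => _ _; apply.
Qed.

(** A long word repeats some letter often enough to contain a power of it that lies in [J]. *)
Let words_in_ideal : exists E, forall w : seq C, size w = E.+1 ->
  exists rho : 'I_N -> E.-tuple C -> K, forall v, X v ->
    word_value v w = \sum_i lin eta i v * \sum_u rho i u * word_value v u.
Proof.
have [D DJ] := letter_nilpotent; exists (#|C| * D)%N => w wE.
have [c cD] : exists c, (D < count_mem c w)%N.
  by apply: pigeonhole_word; rewrite wE.
have [r rE] : J (\prod_(c <- w) letter K c).
  rewrite (bigID (pred1 c)) /=.
  rewrite (eq_bigr (fun=> letter K c)) => [|c' /eqP -> //].
  rewrite big_const_seq iter_mulr_1 -(subnK (ltnW cD)) exprD mulrC mulrA.
  by case: J_ideal => _ _; apply.
have [rho rhoE] := choice (fun i => coef_graded_eval (r i)).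
exists (fun i => rho i _) => v Xv.
have := rE v Xv; rewrite graded_eval_word wE.
(* Each linear form takes up one degree, so only the part of [r i] of degree [#|C| * D] enters. *)
move=> /(congr1 (fun s : {poly K} => s`_(#|C| * D).+1)).
rewrite coefZ coefXn eqxx mulr1 coef_sum => ->; apply: eq_bigr => i _.
by rewrite -scalerAl coefZ coefXM /= rhoE.
Qed.

Lemma elimination_det : exists k (rho : 'I_k -> 'I_k -> 'I_N -> K) (h : 'I_k -> C),
  forall (e : 'I_N -> C -> K) (v : C -> K), X v -> (exists c, v c != 0) ->
    (forall i, \sum_c e i c * v c = 0) ->
    \det (1%:M - \matrix_(a, b) \sum_i (eta i (h b) - e i (h b)) * rho a b i) = 0.
Proof.
have [E EP] := words_in_ideal.
pose T : finType := (C * E.-tuple C)%type.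
have TP (t : T) : exists rho : 'I_N -> E.-tuple C -> K, forall v, X v ->
    word_value v (t.1 :: t.2) =
    \sum_i lin eta i v * \sum_u rho i u * word_value v u.
  by apply: EP; rewrite /= size_tuple.
have [rho rhoE] := choice TP.
exists #|T|, (fun a b i => rho (enum_val a) i (enum_val b).2).
exists (fun b => (enum_val b).1) => e v Xv [c vc0] ev.
apply/eqP/negP => /negP; rewrite -unitfE => Mu.
set M := \matrix_(a, b) _ in Mu.
pose x : 'cV[K]_#|T| := 
    \col_b word_value v ((enum_val b : T).1 :: (enum_val b : T).2).
have Mx : (1%:M - M) *m x = 0.
  apply/eqP; rewrite mulmxBl mul1mx subr_eq0; apply/eqP/matrixP => a j.
  rewrite !mxE rhoE // -(big_mkcond predT).
  transitivity (\sum_(t : T) (\sum_i (eta i t.1 - e i t.1) * rho (enum_val a) i t.2)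
      * word_value v (t.1 :: t.2)); last first.
    rewrite (reindex_onto (@enum_val T predT) enum_rank) => [|t _] /=; last first.
      by rewrite enum_rankK.
    by apply: eq_big => [b|b _]; rewrite ?enum_valK ?eqxx // !mxE.
  rewrite -(pair_bigA _ (fun c' u => (\sum_i (eta i c' - e i c') *
    rho (enum_val a) i u) * word_value v (c' :: u))) /=.
  under [RHS]eq_bigr do under eq_bigr do rewrite mulr_suml.
  under [RHS]eq_bigr do rewrite exchange_big.
  rewrite exchange_big /=; apply: eq_bigr => i _.
  (* As [e i] vanishes at [v], the value of [eta i] is that of [eta i - e i]; its factor [v c']
     becomes the first letter of a word. *)
  transitivity (\sum_c' ((eta i c' - e i c') * v c') *
      \sum_u rho (enum_val a) i u * word_value v u).
    rewrite -mulr_suml; congr (_ * _); under [RHS]eq_bigr do rewrite mulrBl.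
    by rewrite sumrB ev subr0.
  apply: eq_bigr => c' _; rewrite mulr_sumr; apply: eq_bigr => u _.
  by rewrite /word_value big_cons; ring.
have x0 : x = 0 by rewrite -(mulKmx Mu x) Mx mulmx0.
(* The constant word on a letter with [v c != 0] has nonzero value. *)
have /eqP := congr1 (fun y : 'cV_#|T| => y (enum_rank (c, nseq_tuple E c)) 0) x0.
rewrite !mxE enum_rankK /= /word_value big_cons big_nseq iter_mulr_1 -exprS.
by rewrite expf_eq0 (negbTE vc0).
Qed.

End Elimination.

(** * Rank and minors *)

Lemma row_free_rowsub (F : fieldType) (p q r : nat) (A : 'M[F]_(p, q))
  (f : 'I_r -> 'I_p) : injective f -> row_free A -> row_free (rowsub f A).
Proof.
move=> finj /row_freeP[B AB]; apply/row_freeP; exists (colsub f B).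
rewrite -mxsub_mul AB; apply/matrixP => i j.
by rewrite !mxE (inj_eq finj).
Qed.

Lemma rank_leq_minors (F : fieldType) (p q r : nat) (A : 'M[F]_(p, q)) :
  (forall (f : 'I_r.+1 -> 'I_p) (g : 'I_r.+1 -> 'I_q), \det (mxsub f g A) = 0) ->
  (\rank A <= r)%N.
Proof.
move=> minors; rewrite leqNgt; apply/negP => rA.
pose f := maxrankfun A \o widen_ord rA.
have fA : row_free (rowsub f A).
  rewrite -[A in rowsub _ A](mxsub_id A) -mxsub_comp.
  have -> : mxsub (id \o f) (id \o id) A =
      rowsub (widen_ord rA) (rowsub (maxrankfun A) A).
    by apply/matrixP => i j; rewrite !mxE.
  apply: row_free_rowsub (maxrowsub_free A) => i j /(congr1 val) /= ij.
  exact: val_inj.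
have fA' : row_full (rowsub f A)^T.
  by rewrite /row_full mxrank_tr; move: fA.
have := fullrowsub_unit fA'; rewrite unitmxE -det_tr.
have -> : (rowsub (fullrankfun fA') (rowsub f A)^T)^T = mxsub f (fullrankfun fA') A.
  by apply/matrixP => i j; rewrite !mxE.
by rewrite minors unitr0.
Qed.

Lemma det_mxsub_rank (F : fieldType) (p q r : nat) (A : 'M[F]_(p, q))
  (f : 'I_r.+1 -> 'I_p) (g : 'I_r.+1 -> 'I_q) :
  (\rank A <= r)%N -> \det (mxsub f g A) = 0.
Proof.
move=> /rank_factor[L [R ->]]; rewrite mxsub_mul.
apply/eqP/negP => /negP; rewrite -unitfE -unitmxE => /mxrank_unit rk.
have := mxrankM_maxl (rowsub f L) (colsub g R); rewrite rk => h.
by have := leq_trans h (rank_leq_col _); rewrite ltnn.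
Qed.

(** * Polynomial functions on the space of gluings *)

Section PolynomialFunctions.
Variables (K : fieldType) (n : nat).
Implicit Types phi psi : gluing K n -> K.

Definition polyfun phi :=
  exists f : {mpoly K[n.+2 * (2 + 2)]}, forall g, phi g = f.@[coords g].

Lemma polyfun_const c : polyfun (fun=> c).
Proof. by exists c%:MP => g; rewrite mevalC. Qed.

Lemma polyfunM phi psi :
  polyfun phi -> polyfun psi -> polyfun (fun g => phi g * psi g).
Proof. by move=> [f fE] [h hE]; exists (f * h) => g; rewrite mevalM fE hE. Qed.

Lemma polyfunB phi psi :
  polyfun phi -> polyfun psi -> polyfun (fun g => phi g - psi g).
Proof. by move=> [f fE] [h hE]; exists (f - h) => g; rewrite mevalB fE hE. Qed.

Lemma polyfunX phi k : polyfun phi -> polyfun (fun g => phi g ^+ k).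
Proof. by move=> [f fE]; exists (f ^+ k) => g; rewrite rmorphXn /= fE. Qed.

Lemma polyfun_sum (I : Type) (r : seq I) (P : pred I) (phi : I -> gluing K n -> K) :
  (forall i, polyfun (phi i)) -> polyfun (fun g => \sum_(i <- r | P i) phi i g).
Proof.
move=> /choice[f fE]; exists (\sum_(i <- r | P i) f i) => g.
by rewrite rmorph_sum; apply: eq_bigr => i _; rewrite fE.
Qed.

Lemma polyfun_prod (I : Type) (r : seq I) (P : pred I) (phi : I -> gluing K n -> K) :
  (forall i, polyfun (phi i)) -> polyfun (fun g => \prod_(i <- r | P i) phi i g).
Proof.
move=> /choice[f fE]; exists (\prod_(i <- r | P i) f i) => g.
by rewrite rmorph_prod; apply: eq_bigr => i _; rewrite fE.
Qed.

Lemma polyfun_det k (A : gluing K n -> 'M[K]_k) :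
  (forall i j, polyfun (fun g => A g i j)) -> polyfun (fun g => \det (A g)).
Proof.
move=> AP; apply: polyfun_sum => s; apply: polyfunM; first exact: polyfun_const.
by apply: polyfun_prod => i; apply: AP.
Qed.

Lemma polyfun_fst i j : polyfun (fun g => g.1 i j).
Proof.
exists 'X_(mxvec_index i (lshift 2 j)) => g.
by rewrite mevalXU /coords mxvecE row_mxEl.
Qed.

Lemma polyfun_snd i j : polyfun (fun g => g.2 i j).
Proof.
exists 'X_(mxvec_index i (rshift 2 j)) => g.
by rewrite mevalXU /coords mxvecE row_mxEr.
Qed.

Lemma polyfun_comp phi (T : gluing K n -> gluing K n) : polyfun phi ->
  (forall i j, polyfun (fun g => (T g).1 i j)) ->
  (forall i j, polyfun (fun g => (T g).2 i j)) ->
  polyfun (fun g => phi (T g)).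
Proof.
move=> [f fE] T1 T2.
have /choice[t tE] k : polyfun (fun g => coords (T g) k).
  rewrite /coords; case/mxvec_indexP: k => i j.
  case: (split_ordP j) => l ->.
    have [h hE] := T1 i l; exists h => g.
    by rewrite mxvecE row_mxEl hE.
  have [h hE] := T2 i l; exists h => g.
  by rewrite mxvecE row_mxEr hE.
exists (f \mPo [tuple t k | k < _]) => g.
rewrite fE comp_mpoly_meval; apply: meval_eq => k.
by rewrite tnth_mktuple tE.
Qed.

Lemma polyfun_line phi (g h : gluing K n) : polyfun phi ->
  exists s : {poly K}, forall u, phi (g + u *: h) = s.[u].
Proof.
move=> [f fE].
exists (mmap polyC (fun k => (coords g k)%:P + coords h k *: 'X) f) => u.
rewrite fE mevalE /mmap horner_sum; apply: eq_bigr => m _.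
rewrite hornerM hornerC; congr (_ * _).
rewrite /mmap1 horner_prod; apply: eq_bigr => k _.
rewrite horner_exp hornerD hornerC hornerZ hornerX; congr (_ ^+ _).
rewrite /coords; case/mxvec_indexP: k => i j; rewrite !mxvecE.
by case: (split_ordP j) => l ->; rewrite ?row_mxEl ?row_mxEr !mxE mulrC.
Qed.

End PolynomialFunctions.

(** * The bad locus *)

Section BadGluings.
Variables (K : numFieldType) (n : nat).
Implicit Types g : gluing K n.

Definition biform p q (A : 'M[K]_(p.+1, q.+1)) (u v : 'rV[K]_2) : K :=
  (veronese p u *m A *m (veronese q v)^T) 0 0.

Lemma biformE p q (A : 'M[K]_(p.+1, q.+1)) u v :
  biform A u v = \sum_a \sum_b A a b * (veronese p u 0 a * veronese q v 0 b).
Proof.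
rewrite /biform mxE exchange_big; apply: eq_bigr => b _ /=.
by rewrite mxE mulr_suml; apply: eq_bigr => a _; rewrite [in X in _ * X]mxE; ring.
Qed.

(* The pencils on the two components attached to a scroll combine into a form
   of bidegree (p, q) and rank at most 2 vanishing at all nodes.  Such forms
   depend on 2 (p + q) - 1 parameters, so this is a proper condition as soon as
   2 (p + q) <= n + 2. *)
Definition bad_gluing m : set (gluing K n) := [set g |
  exists p q (A : 'M[K]_(p.+1, q.+1)), [/\ (p + q)%N = m, A != 0,
    (\rank A <= 2)%N & forall i, biform A (row i g.1) (row i g.2) = 0]].

Definition affine_point (j : nat) : 'rV[K]_2 := \row_(l < 2) j%:R ^+ l.

Lemma veronese_affine_point a j k : veronese a (affine_point j) 0 k = j%:R ^+ k.
Proof. by rewrite !mxE /= expr0 expr1n mul1r expr1. Qed.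

(* The nodes (j, j) for j <= m and (j, j + 1) for j < m - 1, which force a form
   of bidegree (p, q) with p + q = m to vanish on y = x and on y = x + 1. *)
Definition shift_gluing m : gluing K n :=
  (\matrix_(i < n.+2) affine_point (if (i <= m)%N then i : nat else i - m.+1)%N,
   \matrix_(i < n.+2) affine_point (if (i <= m)%N then i : nat else i - m)%N).

(** Elimination on the cone [X] of matrices of rank at most 2, the linear forms being the
    evaluations at the nodes. *)
Lemma bad_gluing_equation m p q : (p + q = m)%N -> (m.*2 <= n.+2)%N ->
  exists phi : gluing K n -> K, [/\ polyfun phi, phi (shift_gluing m) != 0 &
    forall g (A : 'M[K]_(p.+1, q.+1)), A != 0 -> (\rank A <= 2)%N ->
      (forall i, biform A (row i g.1) (row i g.2) = 0) -> phi g = 0].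
Proof.
move=> pqm mn.
pose C : finType := ('I_p.+1 * 'I_q.+1)%type.
pose mx (v : C -> K) : 'M[K]_(p.+1, q.+1) := \matrix_(a, b) v (a, b).
pose X : set (C -> K) := [set v | \rank (mx v) <= 2]%N.
pose e g i (c : C) :=
  veronese p (row i g.1) 0 c.1 * veronese q (row i g.2) 0 c.2.
have bE g v i : \sum_c e g i c * v c = biform (mx v) (row i g.1) (row i g.2).
  rewrite biformE pair_bigA; apply: eq_bigr => -[a b] _ /=.
  by rewrite mxE mulrC.
have shE i (c : C) : e (shift_gluing m) i c =
    (if (i <= m)%N then i : nat else i - m.+1)%N%:R ^+ c.1 *
    (if (i <= m)%N then i : nat else i - m)%N%:R ^+ c.2.
  by rewrite /e !rowK !veronese_affine_point.
have [|k [rho [h hP]]] := @elimination_det K C n.+2 X (e (shift_gluing m)).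
  move=> F phi phiX phi0 c.
  (* [K] embeds in [F], so [F] has characteristic 0, as the shift argument demands. *)
  pose f : {rmorphism K -> F} := phi \o @mpolyC #|C| K.
  have natF : injective (fun i : nat => i%:R : F).
    move=> i j ij; apply/eqP; rewrite -(@eqr_nat K); apply/eqP/(fmorph_inj f).
    by rewrite !rmorph_nat.
  pose A : 'M[F]_(p.+1, q.+1) := \matrix_(a, b) phi (letter K (a, b)).
  suff A0 : A = 0.
    by case: c => a b; have := congr1 (fun B : 'M__ => B a b) A0; rewrite !mxE.
  apply: (rank2_eq0 natF).
  (* The 3 x 3 minors of the generic matrix vanish on [X], so [phi] kills them. *)
  - apply: rank_leq_minors => r s.
    pose B : 'M[{mpoly K[#|C|]}]_(p.+1, q.+1) := \matrix_(a, b) letter K (a, b).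
    have -> : mxsub r s A = map_mx phi (mxsub r s B).
      by apply/matrixP => i j; rewrite !mxE.
    rewrite det_map_mx; apply: phiX => v Xv; rewrite -det_map_mx.
    have -> : map_mx (graded_eval v) (mxsub r s B) =
        'X *: map_mx polyC (mxsub r s (mx v)).
      apply/matrixP => i j; rewrite !mxE graded_eval_letter.
      by rewrite -mul_polyC mulrC.
    by rewrite detZ det_map_mx det_mxsub_rank // rmorph0 mulr0.
  - move=> j; rewrite pqm => jm.
    have jn : (j < n.+2)%N by lia.
    rewrite pair_bigA -[RHS](phi0 (Ordinal jn)); apply: eq_bigr => -[a b] _ /=.
    rewrite mxE shE /= jm mulrC -!(rmorph_nat f) -!rmorphXn -rmorphM.
    by [].
  - move=> j; rewrite pqm => jm.
    (* The node of index m + 1 + j is the pair (j, j + 1). *)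
    have jn : (m.+1 + j < n.+2)%N by lia.
    rewrite pair_bigA -[RHS](phi0 (Ordinal jn)); apply: eq_bigr => -[a b] _ /=.
    have -> : e (shift_gluing m) (Ordinal jn) (a, b) = j%:R ^+ a * j.+1%:R ^+ b.
      have jm1 : (m.+1 + j <= m)%N = false by lia.
      by rewrite shE /= jm1 addKn addSnnS addKn.
    rewrite mxE.
    by rewrite mulrC -!(rmorph_nat f) -!rmorphXn -rmorphM.
exists (fun g => \det (1%:M - \matrix_(a, b)
   \sum_i (e (shift_gluing m) i (h b) - e g i (h b)) * rho a b i)); split.
- apply: polyfun_det => a b.
  under eq_fun do rewrite mxE [X in _ + X]mxE [X in _ - X]mxE.
  apply: polyfunB; first exact: polyfun_const.
  apply: polyfun_sum => i; apply: polyfunM; last exact: polyfun_const.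
  apply: polyfunB; first exact: polyfun_const.
  rewrite /e; under eq_fun do rewrite !mxE.
  have := (polyfunX, polyfunM, polyfun_fst, polyfun_snd) => H.
  by do !apply: polyfunM; apply: polyfunX; apply: polyfun_fst || apply: polyfun_snd.
(* At the special nodes the perturbation is zero and the determinant is 1. *)
- set B := \matrix_(a, b) _.
  have -> : B = 0.
    by apply/matrixP => a b; rewrite !mxE big1 // => i _; rewrite subrr mul0r.
  by rewrite subr0 det1 oner_eq0.
move=> g A A0 rA Ag.
have mxA : mx (fun c => A c.1 c.2) = A by apply/matrixP => a b; rewrite mxE.
apply: (hP _ (fun c => A c.1 c.2)).
- by rewrite /X /= mxA.
- apply: contrapT => /forallNP A00; case/eqP: A0; apply/matrixP => a b.
  by rewrite mxE; apply/eqP/negP => /negP; apply: (A00 (a, b)).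
- by move=> i; rewrite bE mxA.
Qed.

Lemma bad_gluing_closed m : (m.*2 <= n.+2)%N ->
  exists phi : gluing K n -> K, [/\ polyfun phi, phi (shift_gluing m) != 0 &
    forall g, bad_gluing m g -> phi g = 0].
Proof.
move=> mn.
have /choice[phi phiP] (p : 'I_m.+1) :
    exists phi : gluing K n -> K, [/\ polyfun phi, phi (shift_gluing m) != 0 &
    forall g (A : 'M[K]_(p.+1, (m - p).+1)), A != 0 -> (\rank A <= 2)%N ->
      (forall i, biform A (row i g.1) (row i g.2) = 0) -> phi g = 0].
  by apply: bad_gluing_equation => //; rewrite subnKC // -ltnS.
exists (fun g => \prod_p phi p g); split.
- by apply: polyfun_prod => p; case: (phiP p).
- by apply/prodf_neq0 => p _; case: (phiP p).
- move=> g [p [q [A [pqm A0 rA Ag]]]].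
  have pm : (p < m.+1)%N by lia.
  have qE : (q = m - p)%N by lia.
  move: A A0 rA Ag; rewrite qE => A A0 rA Ag.
  apply/eqP/prodf_eq0; exists (Ordinal pm) => //.
  by case: (phiP (Ordinal pm)) => _ _ h; rewrite (h g A).
Qed.

End BadGluings.

(** * Binary forms *)

(** This is multiplicativity at the point at infinity, where evaluation reads off the coefficient of
    index the formal degree. *)
Lemma coefM_top (R : nzRingType) (s r : {poly R}) a b :
  (size s <= a.+1)%N -> (size r <= b.+1)%N -> (s * r)`_(a + b) = s`_a * r`_b.
Proof.
move=> sa rb; have ab : (a < (a + b).+1)%N by rewrite ltnS leq_addr.
rewrite coefM (bigD1 (Ordinal ab)) //= addKn big1 ?addr0 // => j ja.
have [ja'|] := ltnP a j; first by rewrite nth_default ?mul0r // (leq_trans sa).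
rewrite leq_eqVlt => /orP[/eqP jE|ja']; first by rewrite -val_eqE /= jE eqxx in ja.
by rewrite [r`__]nth_default ?mulr0 // (leq_trans rb) //; lia.
Qed.

Lemma size_polyM_bound (R : nzRingType) (s r : {poly R}) a b :
  (size s <= a.+1)%N -> (size r <= b.+1)%N -> (size (s * r)%R <= (a + b).+1)%N.
Proof.
move=> sa rb; apply: leq_trans (size_polyMleq _ _) _.
by rewrite -subn1 leq_subLR add1n -addnS -addSn leq_add.
Qed.

Section HomogeneousEvaluation.
Variable K : fieldType.
Implicit Types (s r : {poly K}) (t : 'rV[K]_2).

(* The value at t of the binary form of degree a with dehomogenization s. *)
Definition heval a s t : K :=
  \sum_(j < a.+1) s`_j * (t 0 0 ^+ (a - j) * t 0 1 ^+ j).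

Lemma heval_form a s t : heval a s t = form_eval (\col_(j < a.+1) s`_j) t.
Proof. by rewrite /form_eval mxE; apply: eq_bigr => j _; rewrite !mxE mulrC. Qed.

Lemma form_eval_heval a (f : 'cV[K]_a.+1) t :
  form_eval f t = heval a (\poly_(j < a.+1) f (inord j) 0) t.
Proof.
rewrite heval_form; congr form_eval; apply/colP => j.
by rewrite mxE coef_poly ltn_ord inord_val.
Qed.

Lemma heval0 a t : heval a 0 t = 0.
Proof. by rewrite /heval big1 // => j _; rewrite coef0 mul0r. Qed.

Lemma hevalD a s r t : heval a (s + r) t = heval a s t + heval a r t.
Proof. by rewrite /heval -big_split; apply: eq_bigr => j _; rewrite coefD mulrDl. Qed.

Lemma hevalZ a c s t : heval a (c *: s) t = c * heval a s t.
Proof. by rewrite /heval mulr_sumr; apply: eq_bigr => j _; rewrite coefZ mulrA. Qed.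

Lemma hevalB a s r t : heval a (s - r) t = heval a s t - heval a r t.
Proof. by rewrite hevalD -scaleN1r hevalZ mulN1r. Qed.

Lemma heval_sum (I : Type) (l : seq I) (P : pred I) a (s : I -> {poly K}) t :
  heval a (\sum_(i <- l | P i) s i) t = \sum_(i <- l | P i) heval a (s i) t.
Proof.
by elim/big_rec2: _ => [|i y x _ <-]; [apply: heval0 | rewrite hevalD].
Qed.

Lemma heval_finite a s t : t 0 0 != 0 -> (size s <= a.+1)%N ->
  heval a s t = t 0 0 ^+ a * s.[t 0 1 / t 0 0].
Proof.
move=> t0 sa; rewrite (horner_coef_wide _ sa) mulr_sumr; apply: eq_bigr => j _.
have ja : (j <= a)%N by rewrite -ltnS.
have -> : t 0 0 ^+ a = t 0 0 ^+ (a - j) * t 0 0 ^+ j by rewrite -exprD subnK.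
by rewrite expr_div_n; field; rewrite expf_neq0.
Qed.

Lemma heval_infinite a s t : t 0 0 = 0 -> heval a s t = s`_a * t 0 1 ^+ a.
Proof.
move=> t0; rewrite /heval big_ord_recr /= subnn expr0 mul1r big1 ?add0r // => j _.
by rewrite t0 expr0n subn_eq0 leqNgt ltn_ord mul0r mulr0.
Qed.

Lemma hevalM a b s r t : (size s <= a.+1)%N -> (size r <= b.+1)%N ->
  heval (a + b) (s * r) t = heval a s t * heval b r t.
Proof.
move=> sa rb; have [t0|t0] := eqVneq (t 0 0) 0.
  by rewrite !heval_infinite // coefM_top // exprD; ring.
rewrite !heval_finite // ?hornerM ?exprD; first by ring.
by apply: leq_trans (size_polyMleq _ _) _; lia.
Qed.

Lemma heval_linear c d t : heval 1 (c%:P + d *: 'X) t = c * t 0 0 + d * t 0 1.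
Proof.
rewrite /heval big_ord_recl big_ord1 !coefD !coefC !coefZ !coefX /= /bump /=.
by rewrite subn0 subnn !expr0 !expr1; ring.
Qed.

Lemma size_linear c d : (size (c%:P + d *: 'X : {poly K})%R <= 2)%N.
Proof.
apply: leq_trans (size_polyD _ _) _; rewrite geq_max.
rewrite (leq_trans (size_polyC_leq1 _)) //.
by rewrite (leq_trans (size_scale_leq _ _)) // size_polyX.
Qed.

Lemma heval_exp k s t : (size s <= 2)%N -> (size (s ^+ k) <= k.+1)%N /\
  heval k (s ^+ k) t = heval 1 s t ^+ k.
Proof.
move=> s2; elim: k => [|k [sk IH]].
  by rewrite !expr0 size_poly1 /heval big_ord1 coef1 !expr0 !mulr1.
split; last by rewrite !exprSr -addn1 hevalM // IH.
rewrite exprS; apply: leq_trans (size_polyMleq _ _) _; lia.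
Qed.

Lemma heval1 k t : heval k 1 t = t 0 0 ^+ k.
Proof.
rewrite /heval big_ord_recl /= coef1 subn0 expr0 mul1r mulr1 big1 ?addr0 // => j _.
by rewrite coef1 /= mul0r.
Qed.

Lemma heval_pad a b s t : (size s <= a.+1)%N ->
  heval (a + b) s t = heval a s t * t 0 0 ^+ b.
Proof. by move=> sa; rewrite -heval1 -hevalM ?mulr1 // size_poly1. Qed.

Lemma heval_eq0 a s : injective (fun i : nat => i%:R : K) ->
  (size s <= a.+1)%N -> (forall t, t != 0 -> heval a s t = 0) -> s = 0.
Proof.
move=> natK sa s0; apply: (poly_nat_roots_eq0 natK (leqnn _)) => i _.
have := s0 (\row_(l < 2) i%:R ^+ l).
rewrite heval_finite ?mxE ?expr0 ?oner_eq0 // expr1n mul1r divr1 expr1; apply.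
by apply/negP => /eqP/rowP/(_ 0)/eqP; rewrite !mxE expr0 oner_eq0.
Qed.

Lemma veronese_mulmx a (M : 'M[K]_2) : exists S : 'M[K]_a.+1,
  forall t, veronese a (t *m M) = veronese a t *m S.
Proof.
pose l j : {poly K} := (M 0 j)%:P + M 1 j *: 'X.
have lP j t : heval 1 (l j) t = (t *m M) 0 j.
  rewrite heval_linear mxE big_ord_recl big_ord1 mulrC [M 1 j * _]mulrC.
  by congr (_ + t _ _ * M _ j); apply: val_inj.
exists (\matrix_(k, j) (l 0 ^+ (a - j) * l 1 ^+ j)`_k) => t.
apply/rowP => j; rewrite [LHS]mxE -!lP.
have [s1 <-] := heval_exp (a - j) t (size_linear (M 0 0) (M 1 0)).
have [s2 <-] := heval_exp j t (size_linear (M 0 1) (M 1 1)).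
rewrite -hevalM // subnK -1?ltnS // heval_form /form_eval !mxE.
by apply: eq_bigr => k _; rewrite !mxE.
Qed.

Lemma row2P (x y : 'rV[K]_2) : x 0 0 = y 0 0 -> x 0 1 = y 0 1 -> x = y.
Proof.
move=> e0 e1; apply/rowP => -[[|[|//]] j2].
  by have -> : Ordinal j2 = 0 by apply: val_inj.
by have -> : Ordinal j2 = 1 by apply: val_inj.
Qed.

Lemma bracket0_eqmx (u v : 'rV[K]_2) : u != 0 -> v != 0 -> bracket u v = 0 ->
  (u == v)%MS.
Proof.
move=> u0 v0 uv.
have sub (x y : 'rV[K]_2) : y != 0 -> bracket x y = 0 -> (x <= y)%MS.
  move=> y0 /eqP; rewrite /bracket subr_eq0 => /eqP xy; apply/sub_rVP.
  have [y00|y00] := eqVneq (y 0 0) 0.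
    have y1 : y 0 1 != 0.
      by apply: contraNneq y0 => y1; apply/eqP; apply: row2P; rewrite ?y00 ?y1 mxE.
    move/eqP: xy; rewrite y00 mulr0 mulf_eq0 (negbTE y1) orbF => /eqP x00.
    by exists (x 0 1 / y 0 1); apply: row2P; rewrite mxE ?y00 ?mulr0 // divfK.
  exists (x 0 0 / y 0 0); apply: row2P; rewrite mxE ?divfK //.
  by rewrite mulrAC xy mulfK.
apply/andP; split; apply: sub => //.
by move: uv; rewrite /bracket => uv; rewrite -[RHS]oppr0 -uv; ring.
Qed.

Lemma bracket_neq0 (u v : 'rV[K]_2) : bracket u v != 0 ->
  u != 0 /\ ~~ (u == v)%MS.
Proof.
move=> uv; split.
  by apply: contraNneq uv => ->; rewrite /bracket !mxE; apply/eqP; ring.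
apply: contra uv => /andP[/sub_rVP[c ->] _]; apply/eqP.
by rewrite /bracket !mxE; ring.
Qed.

End HomogeneousEvaluation.

Lemma veronese_eq0 (K : numFieldType) a k (B : 'M[K]_(a.+1, k)) :
  (forall t, veronese a t *m B = 0) -> B = 0.
Proof.
move=> B0; apply/matrixP => i j; rewrite [RHS]mxE.
have natK : injective (fun i : nat => i%:R : K).
  by move=> x y /eqP; rewrite eqr_nat => /eqP.
pose s := \poly_(i < a.+1) B (inord i) j.
suff s0 : s = 0.
  have := congr1 (fun s : {poly K} => s`_i) s0.
  by rewrite /s coef_poly ltn_ord inord_val coef0.
apply: (@heval_eq0 _ a) => // [|t _]; first exact: size_poly.
rewrite heval_form /form_eval -[RHS](_ : (veronese a t *m B) 0 j = 0); last first.
  by rewrite B0 mxE.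
by rewrite !mxE; apply: eq_bigr => l _; rewrite !mxE /s coef_poly ltn_ord inord_val.
Qed.

(** * Invariance of the bad locus and density of the complement of its closure *)

Section GenericGluing.
Variables (K : numFieldType) (n : nat).
Implicit Types g h : gluing K n.

Lemma biform_eq0 p q (A : 'M[K]_(p.+1, q.+1)) :
  (forall u v, biform A u v = 0) -> A = 0.
Proof.
move=> A0; apply: veronese_eq0 => u; apply: trmx_inj; rewrite trmx0.
apply: veronese_eq0 => v; apply: trmx_inj; rewrite trmx0 trmx_mul trmxK.
by apply/matrixP => i j; rewrite !ord1 [RHS]mxE; apply: A0.
Qed.

Lemma biform_tr p q (A : 'M[K]_(p.+1, q.+1)) u v : biform A^T v u = biform A u v.
Proof.
rewrite /biform; set B := _ *m A *m _.
have -> : veronese q v *m A^T *m (veronese p u)^T = B^T.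
  by rewrite !trmx_mul trmxK mulmxA.
by rewrite mxE.
Qed.

Definition swap_gluing g : gluing K n := (g.2, g.1).

Lemma bad_gluing_swap m g : bad_gluing m g -> bad_gluing m (swap_gluing g).
Proof.
move=> [p [q [A [<- A0 rA Ag]]]]; exists q, p, A^T; split.
- by rewrite addnC.
- by apply: contraNneq A0 => /(congr1 trmx); rewrite trmxK trmx0 => ->.
- by rewrite mxrank_tr.
- by move=> i; rewrite biform_tr Ag.
Qed.

Definition transform_gluing (s : 'S_n.+2) (M1 M2 : 'M[K]_2) (c1 c2 : 'I_n.+2 -> K)
    g : gluing K n :=
  (\matrix_i (c1 i *: (row (s i) g.1 *m M1)),
   \matrix_i (c2 i *: (row (s i) g.2 *m M2))).

Lemma veroneseZ a c (t : 'rV[K]_2) : veronese a (c *: t) = c ^+ a *: veronese a t.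
Proof.
apply/rowP => j; rewrite !mxE !exprMn.
have ja : (j <= a)%N by rewrite -ltnS.
have -> : c ^+ a = c ^+ (a - j) * c ^+ j by rewrite -exprD subnK.
by ring.
Qed.

Lemma bad_gluing_transform m s M1 M2 c1 c2 g : M1 \in unitmx -> M2 \in unitmx ->
  bad_gluing m g -> bad_gluing m (transform_gluing s M1 M2 c1 c2 g).
Proof.
move=> M1u M2u [p [q [A [<- A0 rA Ag]]]].
have [S1 S1P] := veronese_mulmx p (invmx M1).
have [S2 S2P] := veronese_mulmx q (invmx M2).
pose B := S1 *m A *m S2^T.
have BE u v : biform B (u *m M1) (v *m M2) = biform A u v.
  rewrite /biform /B !mulmxA -S1P mulmxK // -mulmxA -trmx_mul -S2P mulmxK //.
exists p, q, B; split=> //.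
- apply: contraNneq A0 => B0; apply/eqP/biform_eq0 => u v.
  by rewrite -BE B0 /biform mulmx0 mul0mx mxE.
- apply: leq_trans (mxrankM_maxl _ _) _.
  exact: leq_trans (mxrankM_maxr _ _) rA.
- move=> i; rewrite !rowK /biform !veroneseZ linearZ -!scalemxAl -scalemxAr.
  set C := _ *m B *m _; have C0 : C 0 0 = 0 by rewrite -[LHS]/(biform _ _ _) BE Ag.
  by rewrite mxE [X in _ * X]mxE C0 !mulr0.
Qed.

(** The complement of the Zariski closure of the bad locus. It inherits the invariance of that
    locus, which the non-vanishing set of one elimination polynomial need not have. *)
Definition off_bad_closure m : set (gluing K n) := [set g |
  exists phi : gluing K n -> K, [/\ polyfun phi,
    forall h, bad_gluing m h -> phi h = 0 & phi g != 0]].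

Lemma off_bad_closure_swap m g :
  off_bad_closure m (swap_gluing g) -> off_bad_closure m g.
Proof.
move=> [phi [phiP phi0 phig]]; exists (phi \o swap_gluing); split=> //.
- apply: polyfun_comp => // i j; [exact: polyfun_snd|exact: polyfun_fst].
- by move=> h /bad_gluing_swap/phi0.
Qed.

Lemma off_bad_closure_transform m s M1 M2 c1 c2 g :
  M1 \in unitmx -> M2 \in unitmx ->
  off_bad_closure m (transform_gluing s M1 M2 c1 c2 g) -> off_bad_closure m g.
Proof.
move=> M1u M2u [phi [phiP phi0 phig]].
exists (phi \o transform_gluing s M1 M2 c1 c2); split=> //.
- apply: polyfun_comp => // i j /=.
    under eq_fun do rewrite !mxE.
    apply: polyfunM; first exact: polyfun_const.
    apply: polyfun_sum => k; under eq_fun do rewrite mxE.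
    by apply: polyfunM; [exact: polyfun_fst|exact: polyfun_const].
  under eq_fun do rewrite !mxE.
  apply: polyfunM; first exact: polyfun_const.
  apply: polyfun_sum => k; under eq_fun do rewrite mxE.
  by apply: polyfunM; [exact: polyfun_snd|exact: polyfun_const].
- by move=> h /(bad_gluing_transform s c1 c2 M1u M2u)/phi0.
Qed.

Lemma proj_equiv_rows s (P P' : 'M[K]_(n.+2, 2)) : proj_equiv s P P' ->
  exists2 M, M \in unitmx & exists c,
    P = \matrix_i (c i *: (row (s i) P' *m M)).
Proof.
move=> [M Mu PP']; exists (invmx M); first by rewrite unitmx_inv.
have /choice[c cE] i : exists c, row i P *m M = c *: row (s i) P'.
  by apply/sub_rVP; case/andP: (PP' i).
exists c; apply/row_matrixP => i; rewrite rowK scalemxAl -cE.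
by rewrite mulmxK.
Qed.

Lemma off_bad_closure_iso m g h :
  binary_iso g h -> off_bad_closure m g -> off_bad_closure m h.
Proof.
have trans s g' h' : proj_equiv s g'.1 h'.1 -> proj_equiv s g'.2 h'.2 ->
    off_bad_closure m g' -> off_bad_closure m h'.
  move=> /proj_equiv_rows[M1 M1u [c1 E1]] /proj_equiv_rows[M2 M2u [c2 E2]].
  move=> Ug; apply: (@off_bad_closure_transform m s M1 M2 c1 c2) => //.
  suff -> : transform_gluing s M1 M2 c1 c2 h' = g' by [].
  by rewrite /transform_gluing -E1 -E2; case: (g').
move=> [s [[e1 e2]|[e1 e2]]] Ug; first exact: (trans s g h).
by apply: off_bad_closure_swap; exact: (trans s g (swap_gluing h)).
Qed.

Definition discriminant g : K :=
  \prod_i \prod_(j | j != i) (bracket (row i g.1) (row j g.1) *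
                              bracket (row i g.2) (row j g.2)).

Lemma polyfun_discriminant : polyfun discriminant.
Proof.
apply: polyfun_prod => i; apply: polyfun_prod => j; rewrite /bracket.
under eq_fun do rewrite !mxE.
by apply: polyfunM; apply: polyfunB; apply: polyfunM;
  (apply: polyfun_fst || apply: polyfun_snd).
Qed.

Lemma discriminantP g : binary_curve g <-> discriminant g != 0.
Proof.
split=> [[[P0 P] [Q0 Q]]|].
  apply/prodf_neq0 => i _; apply/prodf_neq0 => j ji; rewrite eq_sym in ji.
  rewrite mulf_neq0 //; apply/negP => /eqP/bracket0_eqmx.
    by rewrite (negbTE (P _ _ ji)) => h; apply/notF/h.
  by rewrite (negbTE (Q _ _ ji)) => h; apply/notF/h.
move=> /prodf_neq0 D0.
have D i j : i != j -> bracket (row i g.1) (row j g.1) != 0 /\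
    bracket (row i g.2) (row j g.2) != 0.
  rewrite eq_sym => ij; have /prodf_neq0/(_ j ij) := D0 i isT.
  by rewrite mulf_eq0 negb_or => /andP[].
have other (i : 'I_n.+2) : exists j, i != j.
  have [->|i0] := eqVneq i ord0; first by exists ord_max.
  by exists ord0.
split; split.
- by move=> i; have [j /D[/bracket_neq0[]]] := other i.
- by move=> i j /D[/bracket_neq0[]].
- by move=> i; have [j /D[_ /bracket_neq0[]]] := other i.
- by move=> i j /D[_ /bracket_neq0[]].
Qed.

Lemma poly_non_root (s : {poly K}) : s != 0 -> exists u, s.[u] != 0.
Proof.
move=> s0; apply: contrapT => /forallNP s_0; case/eqP: s0.
have natK : injective (fun i : nat => i%:R : K).
  by move=> x y /eqP; rewrite eqr_nat => /eqP.
by apply: (poly_nat_roots_eq0 natK (leqnn _)) => i _; apply/eqP/negP => /negP/s_0.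
Qed.

Lemma general_binary_curve_not_bad m : (m.*2 <= n.+2)%N ->
  for_general_binary_curve (fun g : gluing K n => ~ bad_gluing m g).
Proof.
move=> /(bad_gluing_closed K)[phi [phiP phi1 phi0]].
exists (off_bad_closure m); split; first split.
- by move=> g h _ _ /off_bad_closure_iso; apply.
- exists [set f | forall h, bad_gluing m h -> f.@[coords h] = 0] => g _; split.
    by move=> [psi [[f fE] psi0 psig]]; exists f => [h|]; rewrite -fE //; exact: psi0.
  by move=> [f f0 fg]; exists (fun h => f.@[coords h]); split=> //; exists f.
- move=> V [_ [E VE]] [g0 g0b Vg0].
  have [f Ef fg0] := (VE g0 g0b).1 Vg0.
  (* On the line from [g0] (u = 0) to [shift_gluing] (u = 1), the equation is nonzero at 1, the
     discriminant and [f] at 0; a common non-root exists although [shift_gluing] itself may not be a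
     binary curve. *)
  have lineP := polyfun_line g0 (shift_gluing K n m - g0).
  have [s sE] := lineP _ phiP.
  have [d dE] := lineP _ polyfun_discriminant.
  have [v vE] := lineP (fun g => f.@[coords g]) (ex_intro _ f (fun=> erefl)).
  have s0 : s != 0.
    apply: contraNneq phi1 => s0; apply/eqP.
    by have := sE 1; rewrite scale1r addrC subrK s0 horner0.
  have d0 : d != 0.
    move/discriminantP: g0b; apply: contraNneq => d0; apply/eqP.
    by have := dE 0; rewrite scale0r addr0 d0 horner0.
  have v0 : v != 0.
    apply: contraNneq fg0 => v0; apply/eqP.
    by have := vE 0; rewrite scale0r addr0 v0 horner0.
  have [u] := poly_non_root (mulf_neq0 (mulf_neq0 s0 d0) v0).
  rewrite !hornerM -sE -dE -vE !mulf_eq0 !negb_or => /andP[/andP[su du] vu].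
  set g := g0 + _ in su du vu.
  have gb : binary_curve g by apply/discriminantP.
  exists g => //; split; first by exists phi.
  by apply/(VE g gb); exists f.
- by move=> g _ [psi [_ psi0 psig]] /psi0 e; rewrite e eqxx in psig.
Qed.

End GenericGluing.

Section FormZeros.
Variable K : fieldType.
Implicit Types (s r : {poly K}) (t : 'rV[K]_2).

Definition vanishing_form t : {poly K} := (t 0 1)%:P + (- t 0 0) *: 'X.

Lemma size_vanishing_form t : (size (vanishing_form t) <= 2)%N.
Proof. exact: size_linear. Qed.

Lemma heval_vanishing_form t u : heval 1 (vanishing_form t) u = bracket u t.
Proof. by rewrite heval_linear /bracket; ring. Qed.

Lemma vanishing_form_neq0 t : t != 0 -> vanishing_form t != 0.
Proof.
apply: contraNneq => t0; have := congr1 (fun s : {poly K} => (s`_0, s`_1)) t0.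
rewrite !coefD !coefC !coefZ !coefX /= !mulr0 mulr1 addr0 add0r => -[t1 /eqP].
by rewrite oppr_eq0 => /eqP t00; apply/eqP; apply: row2P; rewrite mxE.
Qed.

(** At infinity the linear form dehomogenizes to a constant, and vanishing means a drop of the
    degree of [s]. *)
Lemma form_factor a s t : t != 0 -> (size s <= a.+2)%N -> heval a.+1 s t = 0 ->
  exists2 r : {poly K}, (size r <= a.+1)%N & s = vanishing_form t * r.
Proof.
move=> t0 sa; have [t00|t00] := eqVneq (t 0 0) 0.
  have t01 : t 0 1 != 0.
    by apply: contraNneq t0 => t01; apply/eqP; apply: row2P; rewrite ?t00 ?t01 mxE.
  rewrite heval_infinite // => /eqP; rewrite mulf_eq0 expf_eq0 (negbTE t01) orbF.
  move=> /eqP sa0; exists ((t 0 1)^-1 *: s); last first.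
    rewrite /vanishing_form t00 oppr0 scale0r addr0 mul_polyC scalerA.
    by rewrite divff // scale1r.
  apply: leq_trans (size_scale_leq _ _) _; apply/leq_sizeP => j.
  rewrite leq_eqVlt => /orP[/eqP <- //|]; exact: (leq_sizeP _ _ sa).
rewrite heval_finite // => /eqP; rewrite mulf_eq0 expf_eq0 (negbTE t00) /= => rt.
have [r rE] := elimT (factor_theorem s (t 0 1 / t 0 0)) rt.
have sE : s = vanishing_form t * ((- t 0 0)^-1 *: r).
  have -> : vanishing_form t = - t 0 0 *: ('X - (t 0 1 / t 0 0)%:P).
    rewrite scalerBr -mul_polyC -[_ *: _%:P]mul_polyC -polyCM addrC.
    by rewrite mulNr mulrC divfK // polyCN opprK mul_polyC.
  by rewrite rE -scalerAl -scalerAr scalerA mulfV ?oppr_eq0 // scale1r mulrC.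
exists ((- t 0 0)^-1 *: r) => //; apply: leq_trans (size_scale_leq _ _) _.
have [->|r0] := eqVneq r 0; first by rewrite size_poly0.
by move: sa; rewrite rE size_Mmonic ?monicXsubC // size_XsubC addn2.
Qed.

Lemma form_roots_eq0 (I : eqType) (p : I -> 'rV[K]_2) (l : seq I) a s :
  (forall i, p i != 0) -> (forall i j, i != j -> bracket (p i) (p j) != 0) ->
  uniq l -> (a < size l)%N -> (size s <= a.+1)%N ->
  (forall i, i \in l -> heval a s (p i) = 0) -> s = 0.
Proof.
move=> p0 pd; elim: a l s => [|a IH] [|i l] s //= /andP[il ul] al sa s0.
  have := s0 i (mem_head _ _); rewrite /heval big_ord1 !expr0 !mulr1 => s00.
  by rewrite (size1_polyC sa) s00.
have [r ra sE] := form_factor (p0 i) sa (s0 i (mem_head _ _)).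
rewrite sE (IH l r) ?mulr0 // => j jl.
have := s0 j; rewrite in_cons jl orbT => /(_ isT)/eqP.
rewrite sE -add1n hevalM ?size_vanishing_form // heval_vanishing_form mulf_eq0.
rewrite (negbTE (pd _ _ _)) => [/eqP //|]; by apply: contraNneq il => <-.
Qed.

Lemma heval_prod (I : Type) (l : seq I) (s : I -> {poly K}) t :
  (forall i, size (s i) <= 2)%N ->
  (size (\prod_(i <- l) s i)%R <= (size l).+1)%N /\
  heval (size l) (\prod_(i <- l) s i) t = \prod_(i <- l) heval 1 (s i) t.
Proof.
move=> s2; elim: l => [|i l [IHs IH]] /=.
  by rewrite !big_nil size_poly1 heval1 expr0.
rewrite !big_cons; split.
    apply: leq_trans (size_polyMleq _ _) _.
    by move: IHs (s2 i); set x := size _; set y := size _; lia.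
by rewrite -add1n hevalM // IH.
Qed.


End FormZeros.

(** * The residue theorem on one component *)

Section Nodes.
Variables (K : numFieldType) (n : nat) (P : 'M[K]_(n.+2, 2)).
Hypothesis Pd : distinct_points P.

Lemma node_neq0 i : row i P != 0. Proof. by case: Pd. Qed.

Lemma node_bracket_neq0 i j : i != j -> bracket (row i P) (row j P) != 0.
Proof.
move=> ij; case: Pd => _ /(_ i j ij); apply: contra => /eqP.
by apply: bracket0_eqmx; apply: node_neq0.
Qed.

Lemma node_roots_eq0 a (s : {poly K}) : (a < n.+2)%N -> (size s <= a.+1)%N ->
  (forall i, heval a s (row i P) = 0) -> s = 0.
Proof.
move=> an sa s0; apply: (form_roots_eq0 node_neq0 node_bracket_neq0
  (enum_uniq 'I_n.+2) _ sa) => [|i _]; last exact: s0.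
by rewrite size_enum_ord.
Qed.

Definition node_weight i : K :=
  \prod_(j < n.+2 | j != i) bracket (row i P) (row j P).

Lemma node_weight_neq0 i : node_weight i != 0.
Proof.
by apply/prodf_neq0 => j ji; apply: node_bracket_neq0; rewrite eq_sym.
Qed.

(* Lagrange interpolation of the form [t, x] F(t) of degree n + 1, evaluated at
   its zero x. *)
Lemma sum_residues_eq0 (s : {poly K}) : (size s <= n.+1)%N ->
  \sum_i heval n s (row i P) / node_weight i = 0.
Proof.
move=> sn; pose v i := vanishing_form (row i P).
have v2 i : (size (v i) <= 2)%N by apply: size_vanishing_form.
pose others i := [seq j <- enum 'I_n.+2 | j != i].
have so i : size (others i) = n.+1.
    rewrite size_filter; have := count_predC (pred1 i) (enum 'I_n.+2).
    by rewrite count_uniq_mem ?enum_uniq // mem_enum size_enum_ord add1n => -[].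
pose L i := \prod_(j <- others i) v j.
have LE i t : (size (L i) <= n.+2)%N /\
    heval n.+1 (L i) t = \prod_(j | j != i) bracket t (row j P).
  have [sL hL] := heval_prod (others i) t v2; rewrite so in sL hL.
  split=> //; rewrite hL big_filter big_enum_cond; apply: eq_bigr => j _.
  exact: heval_vanishing_form.
(* A point [x] off the nodes, so that the product of its brackets can be cancelled at the end. *)
have [x xP] : exists x : 'rV[K]_2, forall j, bracket x (row j P) != 0.
  have [u] : exists u, (\prod_j v j).[u] != 0.
    apply: poly_non_root; apply/prodf_neq0 => j _.
    exact/vanishing_form_neq0/node_neq0.
  rewrite horner_prod => /prodf_neq0 u0; exists (\row_(l < 2) u ^+ l) => j.
  rewrite -heval_vanishing_form heval_finite ?size_vanishing_form //.
    by rewrite !mxE expr0 expr1 mul1r divr1; apply: u0.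
  by rewrite mxE expr0 oner_eq0.
pose G := vanishing_form x * s.
have sG : (size G <= n.+2)%N.
  by rewrite -add1n; apply: size_polyM_bound (size_vanishing_form x) sn.
have GE t : heval n.+1 G t = bracket t x * heval n s t.
  by rewrite -add1n hevalM ?size_vanishing_form // heval_vanishing_form.
pose c i := heval n.+1 G (row i P) / node_weight i.
have /eqP : G - \sum_i c i *: L i = 0.
  apply: (@node_roots_eq0 n.+1) => // [|k].
    apply: leq_trans (size_polyD _ _) _; rewrite geq_max sG size_polyN.
    apply: leq_trans (size_sum _ _ _) _; apply/bigmax_leqP => i _.
    by apply: leq_trans (size_scale_leq _ _) _; case: (LE i x).
  rewrite hevalB heval_sum (bigD1 k) //= hevalZ (LE k _).2 divfK ?node_weight_neq0 //.
  rewrite big1 ?addr0 ?subrr // => i ik; rewrite hevalZ (LE i _).2.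
  rewrite (bigD1 k) 1?eq_sym //= [bracket _ _](_ : _ = 0) ?mul0r ?mulr0 //.
  by rewrite /bracket mulrC subrr.
rewrite subr_eq0 => /eqP GL.
have W0 : \prod_j bracket x (row j P) != 0 by apply/prodf_neq0 => j _; apply: xP.
have := GE x; rewrite {1}GL heval_sum [bracket x x](_ : _ = 0); last first.
  by rewrite /bracket mulrC subrr.
rewrite mul0r => e.
have {}e : - (\prod_j bracket x (row j P)) *
    (\sum_i heval n s (row i P) / node_weight i) = 0.
  rewrite -[RHS]e mulr_sumr; apply: eq_bigr => i _.
  rewrite hevalZ (LE i x).2 /c GE (bigD1 i) //=.
  have -> : bracket (row i P) x = - bracket x (row i P) by rewrite /bracket; ring.
  by field; apply: node_weight_neq0.
by move/eqP: e; rewrite mulf_eq0 oppr_eq0 (negbTE W0) => /eqP.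
Qed.

End Nodes.

(** * Special pencils *)

Lemma heval_row (K : fieldType) a (v : 'rV[K]_a.+1) t :
  heval a (\poly_(j < a.+1) v 0 (inord j)) t = (veronese a t *m v^T) 0 0.
Proof.
rewrite heval_form /form_eval !mxE; apply: eq_bigr => j _.
by rewrite !mxE coef_poly ltn_ord inord_val.
Qed.

Lemma det2_proportional (K : fieldType) (x y : 'cV[K]_2) (l m : K) :
  (l != 0) || (m != 0) -> m *: x = l *: y -> x 0 0 * y 1 0 = x 1 0 * y 0 0.
Proof.
move=> lm /matrixP e; have := e 0 0; have := e 1 0; rewrite !mxE => e1 e0.
have lE : l * (x 0 0 * y 1 0 - x 1 0 * y 0 0) = 0.
  by rewrite mulrBr mulrCA -e1 [l * _]mulrCA -e0; ring.
have mE : m * (x 0 0 * y 1 0 - x 1 0 * y 0 0) = 0.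
  by rewrite mulrBr !mulrA e0 e1; ring.
apply/eqP; rewrite -subr_eq0; case/orP: lm => h0.
  by move/eqP: lE; rewrite mulf_eq0 (negbTE h0).
by move/eqP: mE; rewrite mulf_eq0 (negbTE h0).
Qed.

Section NodeForms.
Variables (K : numFieldType) (n : nat) (P : 'M[K]_(n.+2, 2)).
Hypothesis Pd : distinct_points P.

(** The product of the two forms has degree n and n + 2 zeros. *)
Lemma complementary_form_eq0 e (v : 'rV[K]_e.+1) (s : {poly K}) : (e <= n)%N ->
  s != 0 -> (size s <= (n - e).+1)%N ->
  (forall i, (veronese e (row i P) *m v^T) 0 0 = 0 \/
             heval (n - e) s (row i P) = 0) -> v = 0.
Proof.
move=> en s0 ss vs; pose r := \poly_(j < e.+1) v 0 (inord j).
have sr : (size r <= e.+1)%N by apply: size_poly.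
suff r0 : r = 0.
  apply/rowP => j; have := congr1 (fun r : {poly K} => r`_j) r0.
  by rewrite coef_poly ltn_ord inord_val coef0 mxE.
have /eqP : r * s = 0.
  apply: (node_roots_eq0 Pd (a := n)) => // [|i].
    by have := size_polyM_bound sr ss; rewrite subnKC.
  rewrite -{1}(subnKC en) hevalM // heval_row.
  by case: (vs i) => ->; rewrite ?mul0r ?mulr0.
by rewrite mulf_eq0 (negbTE s0) orbF => /eqP.
Qed.

Lemma sum_residues_monomial e (s : {poly K}) k : (e <= n)%N -> (k <= e)%N ->
  (size s <= (n - e).+1)%N ->
  \sum_i veronese e (row i P) 0 (inord k) *
    (heval (n - e) s (row i P) / node_weight P i) = 0.
Proof.
move=> en ke ss; have sk : (size ('X^k : {poly K}) <= e.+1)%N by rewrite size_polyXn.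
have sks : (size ('X^k * s)%R <= n.+1)%N.
  by have := size_polyM_bound sk ss; rewrite subnKC.
rewrite -[RHS](sum_residues_eq0 Pd sks); apply: eq_bigr => i _.
have -> : heval n ('X^k * s) (row i P) = heval (e + (n - e)) ('X^k * s) (row i P).
  by rewrite subnKC.
rewrite hevalM // mulrA; congr (_ * _ / _).
rewrite /heval (bigD1 (inord k)) //= coefXn inordK ?eqxx ?mul1r //.
rewrite big1 ?addr0 => [|j /negbTE jk]; first by rewrite mxE inordK.
by rewrite coefXn (_ : (nat_of_ord j == k) = false) ?mul0r // -jk -val_eqE /= inordK.
Qed.

End NodeForms.

Section Pencils.
Variables (K : numFieldType) (n : nat) (g : gluing K n).
Hypothesis gb : binary_curve g.
Variable W : finType.
Implicit Types h : W -> {poly K}.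

Definition independent h :=
  forall c : W -> K, \sum_w c w *: h w = 0 -> forall w, c w = 0.

Lemma independent_neq0 h w : independent h -> h w != 0.
Proof.
move=> hind; apply: contraNneq (oner_neq0 K) => hw; apply/eqP.
have := hind (fun u => (u == w)%:R) _ w; rewrite eqxx; apply.
rewrite big1 // => u _; case: (eqVneq u w) => [->|]; last by rewrite scale0r.
by rewrite hw scaler0.
Qed.

(* By the residue theorem, the pairs (h w, h' w) are annihilated by the sections
   of bidegree (e1, e2) of the line bundle that the proportionality factors
   define, so they count the failure of the gluing conditions on such sections
   to be independent: there remain two sections (sigma, sigma'), (tau, tau'). *)
Lemma bad_of_special_sections e1 e2 h h' :
  (e1 <= n)%N -> (e2 <= n)%N -> (n.+2 <= #|W| + (e1 + e2))%N ->
  independent h -> (exists w, h' w != 0) ->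
  (forall w, size (h w) <= (n - e1).+1)%N ->
  (forall w, size (h' w) <= (n - e2).+1)%N ->
  (forall i, exists l m : K, (l != 0) || (m != 0) /\ forall w,
    l * heval (n - e1) (h w) (row i g.1) + m * heval (n - e2) (h' w) (row i g.2) = 0) ->
  bad_gluing (e1 + e2) g.
Proof.
case: gb => Pd Qd e1n e2n card hind [w0 h'w0] sh sh' par.
have hw0 : h w0 != 0 by apply: independent_neq0.
have wP i := node_weight_neq0 Pd i; have wQ i := node_weight_neq0 Qd i.
(* Division by the weights turns values into residues, up to sign. *)
pose a w i := heval (n - e1) (h w) (row i g.1) / node_weight g.1 i.
pose b w i := heval (n - e2) (h' w) (row i g.2) / node_weight g.2 i.
have /choice[lm lmP] i : exists lm : K * K, (lm.1 != 0) || (lm.2 != 0) /\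
    forall w, lm.1 * a w i + lm.2 * b w i = 0.
  have [l [m [lm0 lmE]]] := par i.
  exists (l * node_weight g.1 i, m * node_weight g.2 i); split=> [|w] /=.
    by rewrite !mulf_eq0 !negb_or wP wQ !andbT.
  by rewrite -[RHS](lmE w) /a /b; field; rewrite wP wQ.
pose l i := (lm i).1; pose m i := (lm i).2.
have lm0 i : (l i != 0) || (m i != 0) by case: (lmP i).
have labm i w : l i * a w i + m i * b w i = 0 by case: (lmP i).
(* The pair (a, b) is a multiple of (m, -l) at each node; [c] is the factor. *)
pose c w i := if m i == 0 then - b w i / l i else a w i / m i.
have aE w i : a w i = m i * c w i.
  rewrite /c; case: eqP => [mi0|/eqP mi]; last by rewrite mulrC divfK.
  have := lm0 i; rewrite mi0 eqxx orbF mul0r => li.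
  by have /eqP := labm i w; rewrite mi0 mul0r addr0 mulf_eq0 (negbTE li) => /eqP.
have bE w i : b w i = - l i * c w i.
  rewrite /c; case: eqP => [mi0|/eqP mi].
    have := lm0 i; rewrite mi0 eqxx orbF => li.
    by rewrite mulNr mulrCA divff // mulr1 opprK.
  have mb : m i * b w i = - (l i * a w i) by apply/eqP; rewrite -addr_eq0 addrC labm.
  by apply: (mulfI mi); rewrite mb; field.
(* The left kernel of [G] consists of the pairs (sigma, sigma') of degrees e1, e2 with m sigma(P_i)
   = l sigma'(Q_i) at each node. *)
pose G : 'M[K]_(e1.+1 + e2.+1, n.+2) := col_mx
  (\matrix_(x, i) (m i * veronese e1 (row i g.1) 0 x))
  (\matrix_(x, i) (- l i * veronese e2 (row i g.2) 0 x)).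
pose C : 'M[K]_(#|W|, n.+2) := \matrix_(w, i) c (enum_val w) i.
have GC : G *m C^T = 0.
  rewrite /G mul_col_mx -[RHS]col_mx0; congr col_mx; apply/matrixP => x w.
    rewrite !mxE -[RHS](sum_residues_monomial Pd (s := h (enum_val w)) (k := x) e1n _ _) //.
      by apply: eq_bigr => i _; rewrite !mxE inord_val -/(a _ i) aE; ring.
    by rewrite -ltnS.
  rewrite !mxE -[RHS](sum_residues_monomial Qd (s := h' (enum_val w)) (k := x) e2n _ _) //.
    by apply: eq_bigr => i _; rewrite !mxE inord_val -/(b _ i) bE; ring.
  by rewrite -ltnS.
have Cfree : row_free C.
  apply: inj_row_free => v vC.
  pose k w := v 0 (enum_rank w).
  suff k0 w : k w = 0 by apply/rowP => w; rewrite mxE -(k0 (enum_val w)) /k enum_valK.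
  apply: (hind k) w; apply: (node_roots_eq0 Pd (a := n - e1)).
  - by rewrite ltnS (leq_trans (leq_subr _ _)).
  - apply: leq_trans (size_sum _ _ _) _; apply/bigmax_leqP => w _.
    exact: leq_trans (size_scale_leq _ _) (sh w).
  move=> i; rewrite heval_sum; apply: (mulIf (invr_neq0 (wP i))).
  rewrite mul0r mulr_suml.
  transitivity (m i * (v *m C) 0 i); last by rewrite vC mxE mulr0.
  rewrite mxE mulr_sumr [LHS](reindex_onto (@enum_val W predT) enum_rank) /=; last first.
    by move=> w _; rewrite enum_rankK.
  apply: eq_big => [w|w _]; first by rewrite enum_valK eqxx.
  by rewrite hevalZ !mxE /k enum_valK -mulrA -/(a _ i) aE; ring.
have rG : (\rank G + #|W| <= n.+2)%N.
  by rewrite -(eqP Cfree) -(mxrank_tr C); apply: mulmx0_rank_max.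
(* There are e1 + e2 + 2 rows, and the rank is at most n + 2 - |W|. *)
have r2 : (2 <= \rank (kermx G))%N by rewrite mxrank_ker; lia.
pose Z := rowsub (widen_ord r2) (row_base (kermx G)).
have Zfree : row_free Z.
  apply: row_free_rowsub (row_base_free _) => i j /(congr1 val) /= ij.
  exact: val_inj.
have ZG : Z *m G = 0.
  rewrite /Z mul_rowsub_mx; have -> : row_base (kermx G) *m G = 0.
    by apply/sub_kermxP; rewrite eq_row_base.
  by apply/matrixP => i j; rewrite !mxE.
pose L := lsubmx Z; pose R := rsubmx Z.
have ZE : Z = row_mx L R by rewrite hsubmxK.
(* The alternating form: [L^T *m J *m R] is sigma (x) tau' - tau (x) sigma'. *)
pose J : 'M[K]_2 := \matrix_(i, j) (if (i == 0) && (j == 1) then 1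
  else if (i == 1) && (j == 0) then -1 else 0).
have node (z : 'rV[K]_2) i : m i * (veronese e1 (row i g.1) *m (z *m L)^T) 0 0 =
    l i * (veronese e2 (row i g.2) *m (z *m R)^T) 0 0.
  have : (z *m Z *m G) 0 i = 0 by rewrite -mulmxA ZG mulmx0 mxE.
  rewrite ZE mul_mx_row mul_row_col mxE => /eqP; rewrite addr_eq0 => /eqP e.
  transitivity (((z *m L) *m (\matrix_(x, i) (m i * veronese e1 (row i g.1) 0 x))) 0 i).
    by rewrite !mxE mulr_sumr; apply: eq_bigr => x _; rewrite !mxE; ring.
  rewrite e !mxE mulr_sumr -sumrN; apply: eq_bigr => x _; rewrite !mxE; ring.
have LRinj (z : 'rV[K]_2) : z *m L = 0 -> z *m R = 0 -> z = 0.
  move=> zL zR; apply: (row_free_inj Zfree).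
  by rewrite mul0mx ZE mul_mx_row zL zR row_mx0.
(* If the second component vanishes, then at each node either the first one does or [m i = 0], and
   then [h w0] does. *)
have Rinj (z : 'rV[K]_2) : z *m R = 0 -> z = 0.
  move=> zR; apply: LRinj => //.
  apply: (complementary_form_eq0 Pd e1n hw0 (sh w0)) => i.
  have e0 : (veronese e2 (row i g.2) *m (z *m R)^T) 0 0 = 0.
    by rewrite zR trmx0 mulmx0 mxE.
  have /eqP := node z i; rewrite e0 mulr0 mulf_eq0.
  move=> /orP[/eqP mi0|/eqP ->]; last by left.
  by right; apply/eqP; have := aE w0 i; rewrite mi0 mul0r => /eqP;
    rewrite mulf_eq0 invr_eq0 (negbTE (wP i)) orbF.
have Linj (z : 'rV[K]_2) : z *m L = 0 -> z = 0.
  move=> zL; apply: LRinj => //.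
  apply: (complementary_form_eq0 Qd e2n h'w0 (sh' w0)) => i.
  have e0 : (veronese e1 (row i g.1) *m (z *m L)^T) 0 0 = 0.
    by rewrite zL trmx0 mulmx0 mxE.
  have /esym/eqP := node z i; rewrite e0 mulr0 mulf_eq0.
  move=> /orP[/eqP li0|/eqP ->]; last by left.
  by right; apply/eqP; have := bE w0 i; rewrite li0 oppr0 mul0r => /eqP;
    rewrite mulf_eq0 invr_eq0 (negbTE (wQ i)) orbF.
have JE (x y : 'cV[K]_2) : (x^T *m J *m y) 0 0 = x 0 0 * y 1 0 - x 1 0 * y 0 0.
  rewrite mxE big_ord_recl big_ord1 !mxE !big_ord_recl !big_ord0 !mxE /=.
  have -> : lift ord0 ord0 = 1 :> 'I_2 by apply: val_inj.
  by ring.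
have Junit : J \in unitmx.
  have JJ : J *m - J = 1%:M.
    apply/matrixP => -[[|[|//]] ?] [[|[|//]] ?];
    by rewrite !mxE !big_ord_recl !big_ord0 !mxE /=; ring.
  by have [] := mulmx1_unit JJ.
exists e1, e2, (L^T *m J *m R); split=> //.
- apply/negP => /eqP A0.
  have LJ : L^T *m J = 0.
    apply/row_matrixP => x; rewrite row0; apply: Rinj.
    by rewrite -row_mul A0 row0.
  have L0 : L = 0.
    by rewrite -[L]trmxK -(mulmxK Junit L^T) LJ mul0mx trmx0.
  have /rowP/(_ 0) : const_mx 1 = 0 :> 'rV[K]_2 by apply: Linj; rewrite L0 mulmx0.
  by rewrite !mxE => /eqP; rewrite oner_eq0.
- apply: leq_trans (mxrankM_maxl _ _) _; apply: leq_trans (mxrankM_maxr _ _) _.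
  exact: rank_leq_col.
move=> i; pose x := L *m (veronese e1 (row i g.1))^T.
pose y := R *m (veronese e2 (row i g.2))^T.
rewrite /biform !mulmxA -[_ *m L^T]trmxK trmx_mul trmxK -/x -mulmxA -/y JE.
apply/eqP; rewrite subr_eq0; apply/eqP.
apply: (@det2_proportional _ _ _ (l i) (m i)) => //.
apply/colP => r; have := node (delta_mx 0 r) i; rewrite -!rowE.
rewrite !mxE => e.
transitivity (m i * \sum_j veronese e1 (row i g.1) 0 j * (row r L)^T j 0).
  by congr (_ * _); apply: eq_bigr => j _; rewrite !mxE mulrC.
by rewrite e; congr (_ * _); apply: eq_bigr => j _; rewrite !mxE mulrC.
Qed.

End Pencils.

Section PencilInduction.
Variables (K : numFieldType) (n : nat) (g : gluing K n).
Hypothesis gb : binary_curve g.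
Variable W : finType.
Implicit Types h : W -> {poly K}.

Local Notation P i := (row i g.1).
Local Notation Q i := (row i g.2).

(** The form is s0 (x) t1 - s1 (x) t0, with the first degree raised to m - k2 by a power of the
    first coordinate. *)
Lemma bad_of_bipencil k1 k2 m (s0 s1 t0 t1 : {poly K}) : (k1 + k2 <= m)%N ->
  (size s0 <= k1.+1)%N -> (size s1 <= k1.+1)%N ->
  (size t0 <= k2.+1)%N -> (size t1 <= k2.+1)%N ->
  (forall c d, c *: s0 + d *: s1 = 0 -> c = 0 /\ d = 0) ->
  (t0 != 0) || (t1 != 0) ->
  (forall i, heval k1 s0 (P i) * heval k2 t1 (Q i) =
             heval k1 s1 (P i) * heval k2 t0 (Q i)) ->
  bad_gluing m g.
Proof.
move=> km ss0 ss1 st0 st1 sfree tn0 st; pose p := (m - k2)%N.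
have kp : (k1 <= p)%N by rewrite leq_subRL ?(leq_trans (leq_addl _ _) km) // addnC.
have pk2 : (p + k2 = m)%N by rewrite subnK // (leq_trans (leq_addl _ _) km).
pose L : 'M[K]_(p.+1, 2) := \matrix_(a, l) (if l == 0 then s0 else s1)`_a.
pose R : 'M[K]_(2, k2.+1) := \matrix_(l, b) (if l == 0 then t1 else - t0)`_b.
have AE a b : (L *m R) a b = s0`_a * t1`_b - s1`_a * t0`_b.
  by rewrite mxE big_ord_recl big_ord1 !mxE /= coefN mulrN.
exists p, k2, (L *m R); split=> //.
- apply/negP => /eqP A0.
  have e b : t1`_b = 0 /\ - t0`_b = 0.
    have [kb|kb] := ltnP k2 b.
      by split; rewrite nth_default ?oppr0 //;
        [apply: leq_trans st1 kb|apply: leq_trans st0 kb].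
    apply: sfree; apply/polyP => a; rewrite coef0 coefD !coefZ.
    have [ka|ka] := ltnP k1 a.
      rewrite [s0`__]nth_default ?(leq_trans ss0) //.
      rewrite [s1`__]nth_default ?(leq_trans ss1) //.
      by rewrite !mulr0 addr0.
    have ap : (a < p.+1)%N by rewrite ltnS (leq_trans ka).
    have := AE (Ordinal ap) (Ordinal (kb : (b < k2.+1)%N)); rewrite A0 mxE /= => e.
    by rewrite [RHS]e; ring.
  case/orP: tn0 => /eqP[]; apply/polyP => b; rewrite coef0; have [e1 e0] := e b => //.
  by rewrite -[LHS]opprK e0 oppr0.
- by apply: leq_trans (mxrankM_maxl _ _) _; apply: rank_leq_col.
move=> i; rewrite biformE.
transitivity (heval p s0 (P i) * heval k2 t1 (Q i) -
              heval p s1 (P i) * heval k2 t0 (Q i)).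
  rewrite /heval !big_distrlr -sumrB; apply: eq_bigr => a _ /=.
  by rewrite -sumrB; apply: eq_bigr => b _; rewrite AE !mxE; ring.
by rewrite -(subnKC kp) !heval_pad // mulrAC st; ring.
Qed.

(* When k1 + k2 < m and the pencils (s0, s1) and (t0, t1) disagree at some node,
   all h w vanish there, and this zero can be moved from h to s. *)
Lemma bad_of_pencils m k1 k2 (s0 s1 t0 t1 : {poly K}) h h' :
  (m <= n)%N -> (n.+2 <= #|W| + m)%N -> (k1 <= n)%N -> (k2 <= n)%N ->
  (size s0 <= k1.+1)%N -> (size s1 <= k1.+1)%N ->
  (size t0 <= k2.+1)%N -> (size t1 <= k2.+1)%N ->
  (forall w, size (h w) <= (n - k1).+1)%N ->
  (forall w, size (h' w) <= (n - k2).+1)%N ->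
  independent h -> (exists w, h' w != 0) ->
  (forall c d, c *: s0 + d *: s1 = 0 -> c = 0 /\ d = 0) ->
  (t0 != 0) || (t1 != 0) ->
  (forall i, exists c c' : K, [/\ c != 0, c' != 0 & forall w,
     c * (heval k1 s0 (P i) * heval (n - k1) (h w) (P i)) =
     c' * (heval k2 t0 (Q i) * heval (n - k2) (h' w) (Q i)) /\
     c * (heval k1 s1 (P i) * heval (n - k1) (h w) (P i)) =
     c' * (heval k2 t1 (Q i) * heval (n - k2) (h' w) (Q i))]) ->
  (forall i, [|| heval k1 s0 (P i) != 0, heval k1 s1 (P i) != 0,
                 heval k2 t0 (Q i) != 0 | heval k2 t1 (Q i) != 0]) ->
  bad_gluing m g.
Proof.
have [Pd Qd] := gb.
move=> mn card; have [j] := ubnP (m - (k1 + k2)).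
elim: j k1 s0 s1 h => // j IH k1 s0 s1 h; rewrite ltnS => mj.
move=> k1n k2n ss0 ss1 st0 st1 sh sh' hind h'0 sfree tn0 glue nz.
have [mk|mk] := leqP m (k1 + k2).
  (* The degrees k1, k2 are lowered to sum to m exactly, and [h], [h'] are padded by powers of the
     first coordinate. *)
  pose e1 := minn k1 m; pose e2 := (m - e1)%N.
  have e1k : (e1 <= k1)%N by apply: geq_minl.
  have e1m : (e1 <= m)%N by apply: geq_minr.
  have e2k : (e2 <= k2)%N by rewrite /e2 /e1; lia.
  have eE : (e1 + e2 = m)%N by rewrite subnKC.
  have pad e k (s : {poly K}) t : (e <= k)%N -> (k <= n)%N -> (size s <= (n - k).+1)%N ->
      heval (n - e) s t = heval (n - k) s t * t 0 0 ^+ (k - e).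
    by move=> ek kn ss; rewrite -heval_pad //; congr heval; lia.
  rewrite -eE; apply: (bad_of_special_sections gb (h := h) (h' := h')) => //.
  - exact: leq_trans k1n.
  - exact: leq_trans k2n.
  - by rewrite eE.
  - by move=> w; apply: leq_trans (sh w) _; rewrite ltnS leq_sub2l.
  - by move=> w; apply: leq_trans (sh' w) _; rewrite ltnS leq_sub2l.
  move=> i; have [c [c' [c0 c'0 cE]]] := glue i.
  have [l [m' [lm lmE]]] : exists l m' : K, (l != 0) || (m' != 0) /\ forall w,
      l * heval (n - k1) (h w) (P i) + m' * heval (n - k2) (h' w) (Q i) = 0.
    have [z0|z0] := boolP ((heval k1 s0 (P i) == 0) && (heval k2 t0 (Q i) == 0)).
      exists (c * heval k1 s1 (P i)), (- c' * heval k2 t1 (Q i)); split=> [|w].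
        have := nz i; rewrite !mulf_eq0 oppr_eq0 (negbTE c0) (negbTE c'0) /=.
        by move/andP: z0 => [/eqP -> /eqP ->]; rewrite eqxx.
      by rewrite -mulrA (cE w).2; ring.
    exists (c * heval k1 s0 (P i)), (- c' * heval k2 t0 (Q i)); split=> [|w].
      by rewrite !mulf_eq0 oppr_eq0 (negbTE c0) (negbTE c'0) /= -negb_and.
    by rewrite -mulrA (cE w).1; ring.
  pose x := P i 0 0 ^+ (k1 - e1); pose y := Q i 0 0 ^+ (k2 - e2).
  have padE w : heval (n - e1) (h w) (P i) = heval (n - k1) (h w) (P i) * x /\
      heval (n - e2) (h' w) (Q i) = heval (n - k2) (h' w) (Q i) * y.
    by split; apply: pad.
  (* Padding may kill all [h w] at a node at infinity; then (1, 0) is a relation. *)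
  have [x0|x0] := eqVneq x 0.
    exists 1, 0; rewrite oner_eq0; split=> // w.
    by rewrite (padE w).1 x0; ring.
  have [y0|y0] := eqVneq y 0.
    exists 0, 1; rewrite oner_eq0 orbT; split=> // w.
    by rewrite (padE w).2 y0; ring.
  exists (l / x), (m' / y); split=> [|w].
    by rewrite !mulf_eq0 !invr_eq0 (negbTE x0) (negbTE y0) !orbF.
  rewrite (padE w).1 (padE w).2 -[RHS](lmE w); field.
  by rewrite x0 y0.
have [agree|] := pselect (forall i, heval k1 s0 (P i) * heval k2 t1 (Q i) =
                                    heval k1 s1 (P i) * heval k2 t0 (Q i)).
  by apply: (@bad_of_bipencil k1 k2 m s0 s1 t0 t1); rewrite // ltnW.
move=> /existsNP[i /eqP disagree].
have h0 w : heval (n - k1) (h w) (P i) = 0.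
  have [c [c' [c0 c'0 cE]]] := glue i; have [e0 e1] := cE w.
  have : c * heval (n - k1) (h w) (P i) *
      (heval k1 s0 (P i) * heval k2 t1 (Q i) - heval k1 s1 (P i) * heval k2 t0 (Q i)) = 0.
    transitivity (c * (heval k1 s0 (P i) * heval (n - k1) (h w) (P i)) * heval k2 t1 (Q i)
      - c * (heval k1 s1 (P i) * heval (n - k1) (h w) (P i)) * heval k2 t0 (Q i)).
      by ring.
    by rewrite e0 e1; ring.
  by move/eqP; rewrite !mulf_eq0 subr_eq0 (negbTE c0) (negbTE disagree) orbF => /eqP.
have nk1 : (n - k1 = (n - k1.+1).+1)%N by lia.
have /choice[r rP] w : exists r : {poly K}, (size r <= (n - k1.+1).+1)%N /\
    h w = vanishing_form (P i) * r.
  have sw := sh w; have hw := h0 w; rewrite nk1 in sw hw.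
  by have [r] := form_factor (node_neq0 Pd i) sw hw; exists r.
pose v := vanishing_form (P i).
have v0 : v != 0 by apply/vanishing_form_neq0/node_neq0.
have vE (s : {poly K}) t : (size s <= k1.+1)%N ->
    heval k1.+1 (v * s) t = bracket t (P i) * heval k1 s t.
  move=> ss; rewrite -add1n hevalM ?size_vanishing_form //.
  by rewrite heval_vanishing_form.
have vh w t : heval (n - k1) (h w) t = bracket t (P i) * heval (n - k1.+1) (r w) t.
  have [rs ->] := rP w; rewrite nk1 -add1n hevalM ?size_vanishing_form //.
  by rewrite heval_vanishing_form.
apply: (IH k1.+1 (v * s0) (v * s1) r); rewrite //.
- by lia.
- by lia.
- by rewrite -add1n; apply: size_polyM_bound (size_vanishing_form _) ss0.
- by rewrite -add1n; apply: size_polyM_bound (size_vanishing_form _) ss1.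
- by move=> w; case: (rP w).
- move=> c cr w; apply: (hind c) w.
  transitivity (v * \sum_w c w *: r w); last by rewrite cr mulr0.
  by rewrite mulr_sumr; apply: eq_bigr => u _; rewrite (rP u).2 scalerAr.
- move=> c d cd; apply: sfree; apply: (mulfI v0).
  by rewrite mulr0 -[RHS]cd mulrDr !scalerAr.
- move=> k; have [c [c' [c0 c'0 cE]]] := glue k; exists c, c'; split=> // w.
  rewrite !vE // -(cE w).1 -(cE w).2 vh; split; ring.
- move=> k; rewrite !vE // !mulf_eq0; have [->|ki] := eqVneq k i.
    (* The new first pencil vanishes at node [i], but the second does not, as the disagreement there
       shows. *)
    have : (heval k2 t0 (Q i) != 0) || (heval k2 t1 (Q i) != 0).
      by rewrite -negb_and; apply: contra disagree => /andP[/eqP -> /eqP ->]; rewrite !mulr0.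
    by case/orP=> ->; rewrite !orbT.
  by rewrite (negbTE (node_bracket_neq0 Pd ki)) /=; apply: nz.
Qed.

End PencilInduction.

(** * Curves on scrolls *)

Section RankOne.
Variables (K : fieldType) (W : finType) (n : nat) (x y : W -> {poly K}) (w0 : W).
Hypotheses (sx : forall w, (size (x w) <= n.+1)%N)
           (sy : forall w, (size (y w) <= n.+1)%N).
Hypothesis xy : forall w w', x w * y w' = y w * x w'.
Hypotheses (x0 : x w0 != 0) (y0 : y w0 != 0).

Lemma rank_one_factor : exists k (s0 s1 : {poly K}) (h : W -> {poly K}),
  [/\ (k <= n)%N /\ (size s0 <= k.+1)%N /\ (size s1 <= k.+1)%N,
      forall w, (size (h w) <= (n - k).+1)%N,
      forall w, x w = s0 * h w, forall w, y w = s1 * h w &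
      forall t, t != 0 -> (heval k s0 t != 0) || (heval k s1 t != 0)].
Proof.
have [|c [a [b [c0 xE yE cab]]]] := @coprime_factor _ (x w0) (y w0).
  by rewrite x0.
have a0 : a != 0 by apply: contraNneq x0 => a0; rewrite xE a0 mulr0.
have b0 : b != 0 by apply: contraNneq y0 => b0; rewrite yE b0 mulr0.
have ab w : x w * b = y w * a.
  by apply: (mulfI c0); rewrite mulrCA -yE mulrCA -xE xy.
have ax w : a %| x w by rewrite -(Gauss_dvdpl _ cab) ab dvdp_mull.
pose h w := x w %/ a.
have xh w : x w = a * h w by rewrite mulrC divpK.
have yh w : y w = b * h w.
  by apply: (mulIf a0); rewrite -ab xh; ring.
(* As [k] is the larger degree, the coprime [a] and [b] have no common zero at infinity either. *)
pose k := (maxn (size a) (size b)).-1.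
have ka : (size a <= k.+1)%N by rewrite (leq_trans _ (leqSpred _)) // leq_maxl.
have kb : (size b <= k.+1)%N by rewrite (leq_trans _ (leqSpred _)) // leq_maxr.
have kE : k.+1 = size a \/ k.+1 = size b.
  rewrite prednK; last by rewrite leq_max size_poly_gt0 a0.
  by case: (leqP (size a) (size b)); [right|left].
have size_h w : h w != 0 -> (k.+1 + size (h w) <= n.+2)%N.
  move=> h0; case: kE => ->.
    by have := sx w; rewrite xh size_mul // -subn1 leq_subLR add1n.
  by have := sy w; rewrite yh size_mul // -subn1 leq_subLR add1n.
have kn : (k <= n)%N.
  have h0 : h w0 != 0 by apply: contraNneq x0 => h0; rewrite xh h0 mulr0.
  have := leq_trans (leq_add (leqnn k.+1) _) (size_h w0 h0); rewrite -size_poly_gt0 in h0.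
  by move=> /(_ _ h0); rewrite addn1 !ltnS.
exists k, a, b, h; split=> //.
- move=> w; have [->|h0] := eqVneq (h w) 0; first by rewrite size_poly0.
  by move: (size_h w h0) kn; set z := size _; lia.
move=> t t0; rewrite -negb_and; apply/negP => /andP[].
have [t00|t00] := eqVneq (t 0 0) 0.
  have t01 : t 0 1 != 0.
    by apply: contraNneq t0 => t01; apply/eqP; apply: row2P; rewrite ?t00 ?t01 mxE.
  rewrite !heval_infinite // !mulf_eq0 !expf_eq0 (negbTE t01) !andbF !orbF.
  move=> /eqP ak /eqP bk; case: kE => kE.
    by move: a0; rewrite -lead_coef_eq0 lead_coefE -kE ak eqxx.
  by move: b0; rewrite -lead_coef_eq0 lead_coefE -kE bk eqxx.
rewrite !heval_finite // !mulf_eq0 !expf_eq0 (negbTE t00) !andbF /= => ra rb.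
by have := coprimep_root cab ra; rewrite rb.
Qed.

End RankOne.

Section Scroll.
Variables (K : numFieldType) (n d : nat) (a : 'I_d -> nat).

Definition column_form (c : 'cV[K]_n.+1) : {poly K} :=
  \poly_(j < n.+1) c (inord j) 0.

Lemma column_formE c t : heval n (column_form c) t = (veronese n t *m c) 0 0.
Proof. by rewrite -form_eval_heval. Qed.

Lemma column_form_sum (I : finType) (k : I -> K) (c : I -> 'cV[K]_n.+1) :
  \sum_i k i *: column_form (c i) = column_form (\sum_i k i *: c i).
Proof.
apply/polyP => j; rewrite coef_sum coef_poly.
under eq_bigr do rewrite coefZ coef_poly.
case: ifP => _; last by rewrite big1 // => i _; rewrite mulr0.
by rewrite summxE; apply: eq_bigr => i _; rewrite mxE.
Qed.

Lemma column_form_eq0 c : column_form c = 0 -> c = 0.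
Proof.
move=> c0; apply/colP => j; have := congr1 (fun s : {poly K} => s`_j) c0.
by rewrite coef_poly ltn_ord inord_val coef0 mxE.
Qed.

(* The 2 x (n + 1 - d) matrix of linear forms whose minors define the scroll,
   with columns indexed by pairs (i, j), j < a i. *)
Definition scroll_index : finType := {i : 'I_d & 'I_(a i)}.

Variable X : 'M[K]_(n.+1, \sum_(i < d) (a i).+1).

(** The section y_i t_0^(a_i - j) t_1^j of M, restricted to the component as a form of degree n. *)
Definition scroll_entry i (j : 'I_(a i).+1) : {poly K} :=
  column_form (col j (submxrow X i)).

Arguments scroll_entry : clear implicits.

Lemma scroll_entry_free (k : forall i, 'I_(a i).+1 -> K) :
  (forall c : 'cV_(\sum_(i < d) (a i).+1), X *m c = 0 -> c = 0) ->
  \sum_(i < d) \sum_(j < (a i).+1) k i j *: scroll_entry i j = 0 ->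
  forall i j, k i j = 0.
Proof.
move=> Xfree e i j; pose c := \mxcol_i (\col_(j < (a i).+1) k i j).
have c0 : c = 0.
  apply: Xfree; apply: column_form_eq0; rewrite -[RHS]e.
  have -> : \sum_(i < d) \sum_(j < (a i).+1) k i j *: scroll_entry i j =
      column_form (\sum_(i < d) 1 *: \sum_(j < (a i).+1) k i j *: col j (submxrow X i)).
    rewrite -column_form_sum; apply: eq_bigr => l _.
    by rewrite scale1r -column_form_sum.
  congr column_form.
  rewrite -[in LHS](submxrowK X) mul_mxrow_mxcol; apply: eq_bigr => l _.
  rewrite scale1r; apply/colP => r; rewrite mxE summxE; apply: eq_bigr => q _.
  by rewrite !mxE mulrC.
have := mxcolK (fun i => \col_(j < (a i).+1) k i j) i.
by rewrite -/c c0 submxcol0 => /colP/(_ j); rewrite !mxE => <-.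
Qed.

Definition scroll_top (w : scroll_index) : {poly K} :=
  scroll_entry (tag w) (widen_ord (leqnSn _) (tagged w)).

Definition scroll_bottom (w : scroll_index) : {poly K} :=
  scroll_entry (tag w) (lift ord0 (tagged w)).

Hypothesis Xfree : forall c : 'cV_(\sum_(i < d) (a i).+1), X *m c = 0 -> c = 0.

Lemma scroll_top_free : independent scroll_top.
Proof.
move=> c e.
pose k i (j : 'I_(a i).+1) : K :=
  if (insub (nat_of_ord j) : option 'I_(a i)) is Some j'
  then c (Tagged (fun i => 'I_(a i)) j') else 0.
have kE i (j : 'I_(a i)) : k i (widen_ord (leqnSn _) j) = c (Tagged (fun i => 'I_(a i)) j).
  by rewrite /k /= valK.
have k0 : forall i j, k i j = 0.
  apply: scroll_entry_free => //; rewrite -[RHS]e.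
  transitivity (\sum_(i < d) \sum_(j < a i)
      c (Tagged (fun i => 'I_(a i)) j) *: scroll_top (Tagged (fun i => 'I_(a i)) j)); last first.
    by rewrite sig_big_dep; apply: eq_bigr => -[].
  apply: eq_bigr => i _.
  rewrite big_ord_recr /= [X in _ + X](_ : _ = 0) ?addr0; last first.
    by rewrite /k insubF ?ltnn // scale0r.
  by apply: eq_bigr => j _; rewrite kE.
by case=> i j; rewrite -kE k0.
Qed.

Lemma scroll_entry2_free i (j1 j2 : 'I_(a i).+1) c1 c2 : j1 != j2 ->
  c1 *: scroll_entry i j1 + c2 *: scroll_entry i j2 = 0 -> c1 = 0 /\ c2 = 0.
Proof.
move=> j12 e.
pose dl c (j : 'I_(a i).+1) i' (j' : 'I_(a i').+1) : K :=
  c * ((i' == i) && (nat_of_ord j' == j))%:R.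
have dlE c j : \sum_(i' < d) \sum_(j' < (a i').+1) dl c j i' j' *: scroll_entry i' j' =
    c *: scroll_entry i j.
  rewrite (bigD1 i) //= [X in _ + X]big1 ?addr0 => [|i' /negbTE i'i]; last first.
    by rewrite big1 // => j' _; rewrite /dl i'i mulr0 scale0r.
  rewrite (bigD1 j) //= big1 ?addr0 => [|j' j'j].
    by rewrite /dl !eqxx mulr1.
  by rewrite /dl (_ : (nat_of_ord j' == j) = false) ?andbF ?mulr0 ?scale0r //;
    apply/negbTE.
have k0 : forall i' j', dl c1 j1 i' j' + dl c2 j2 i' j' = 0.
  apply: scroll_entry_free => //; rewrite -[RHS]e -!dlE -big_split.
  apply: eq_bigr => i' _; rewrite -big_split; apply: eq_bigr => j' _.
  by rewrite scalerDl.
have := k0 i j1; have := k0 i j2; rewrite /dl !eqxx /= mulr1.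
have nj : (nat_of_ord j1 == j2) = false by apply/negbTE.
by rewrite nj eq_sym nj !mulr0 addr0 add0r mulr1.
Qed.

Hypothesis Xscroll : forall t, t != 0 -> exists ty : 'rV[K]_2 * 'rV[K]_d, exists c,
  veronese n t *m X = c *: \mxrow_(i < d) (ty.2 0 i *: veronese (a i) ty.1).

Lemma scroll_pencil : (exists i, 0 < a i)%N ->
  exists k (s0 s1 : {poly K}) (h : scroll_index -> {poly K}),
  [/\ (k <= n)%N /\ (size s0 <= k.+1)%N /\ (size s1 <= k.+1)%N,
      (forall w, size (h w) <= (n - k).+1)%N /\ independent h,
      (forall w, scroll_top w = s0 * h w) /\ (forall w, scroll_bottom w = s1 * h w),
      forall t, t != 0 -> (heval k s0 t != 0) || (heval k s1 t != 0) &
      forall c1 c2, c1 *: s0 + c2 *: s1 = 0 -> c1 = 0 /\ c2 = 0].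
Proof.
move=> [i0 ai0]; pose w0 : scroll_index := Tagged (fun i => 'I_(a i)) (Ordinal ai0).
have size_entry i j : (size (scroll_entry i j) <= n.+1)%N by apply: size_poly.
have free0 c1 c2 : c1 *: scroll_top w0 + c2 *: scroll_bottom w0 = 0 -> c1 = 0 /\ c2 = 0.
  by apply: scroll_entry2_free.
have top0 : scroll_top w0 != 0.
  apply/negP => /eqP e; have [] := free0 1 0; last by move/eqP; rewrite oner_eq0.
  by rewrite e scaler0 scale0r addr0.
have bot0 : scroll_bottom w0 != 0.
  apply/negP => /eqP e; have [|_] := free0 0 1; last by move/eqP; rewrite oner_eq0.
  by rewrite e scaler0 scale0r addr0.
have minors w w' : scroll_top w * scroll_bottom w' = scroll_bottom w * scroll_top w'.
  apply/eqP; rewrite -subr_eq0; apply/eqP.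
  have natK : injective (fun i : nat => i%:R : K).
    by move=> x y /eqP; rewrite eqr_nat => /eqP.
  apply: (@heval_eq0 _ (n + n)) => // [|t t0].
    apply: leq_trans (size_polyD _ _) _; rewrite geq_max size_polyN.
    by rewrite !size_polyM_bound ?size_entry.
  rewrite hevalB !hevalM ?size_entry // !column_formE.
  have [[u y] [c /= e]] := Xscroll t0.
  have entryE i j : (veronese n t *m col j (submxrow X i)) 0 0 =
      c * (y 0 i * veronese (a i) u 0 j).
    have := congr1 (fun Y => submxrow Y i) e; rewrite /= -mul_submxrow.
    rewrite -[X in _ = X](_ : c *: (y 0 i *: veronese (a i) u) = _); last first.
      apply/rowP => l; rewrite !mxE.
      have := congr1 (fun Y : 'rV_(a i).+1 => Y 0 l) (mxrowK (fun i => y 0 i *: veronese (a i) u) i).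
      by rewrite !mxE => ->.
    move=> /rowP/(_ j); rewrite !mxE => <-.
    by apply: eq_bigr => l _; rewrite !mxE.
  rewrite !entryE !mxE /= /bump /=.
  case: w w' => [i j] [i' j'] /=.
  (* The two entries of a column are u_0 and u_1 times the same factor. *)
  have expE (l : nat) (p : 'I_l) : u 0 0 ^+ (l - p) = u 0 0 * u 0 0 ^+ (l - p.+1).
    by rewrite -exprS subnSK.
  rewrite !add1n !expE !exprS; ring.
have [k [s0 [s1 [h [ks sh xh yh nz]]]]] :=
  @rank_one_factor K _ n scroll_top scroll_bottom w0 (fun w => size_entry _ _)
    (fun w => size_entry _ _) minors top0 bot0.
exists k, s0, s1, h; split=> //.
  split=> // c e; apply: scroll_top_free.
  transitivity (s0 * \sum_w c w *: h w); last by rewrite e mulr0.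
  by rewrite mulr_sumr; apply: eq_bigr => w _; rewrite xh scalerAr.
move=> c1 c2 e; apply: free0; rewrite xh yh !scalerAl -mulrDl e mul0r.
by [].
Qed.

End Scroll.

Arguments scroll_entry {K n d a} X i j.

(** * Canonical sections restricted to the two components *)

Section CanonicalCurve.
Variables (K : numFieldType) (n : nat) (g : gluing K n) (A B : 'M[K]_n.+1).
Hypotheses (gb : binary_curve g) (AB : canonical_basis g A B).

Lemma canonical_columns (c : 'cV[K]_n.+1) : canonical_section g (A *m c) (B *m c).
Proof. by apply/(AB.2 _ _); exists c. Qed.

Lemma residueE (P : 'M[K]_(n.+2, 2)) (c : 'cV[K]_n.+1) i :
  residue P c i = - (heval n (column_form c) (row i P) / node_weight P i).
Proof. by rewrite column_formE. Qed.

Lemma residues_eq0 (P : 'M[K]_(n.+2, 2)) (c : 'cV[K]_n.+1) : distinct_points P ->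
  (forall i, residue P c i = 0) -> c = 0.
Proof.
move=> Pd c0; apply: column_form_eq0; apply: (node_roots_eq0 Pd (a := n)) => // [|i].
  exact: size_poly.
have /eqP := c0 i; rewrite residueE oppr_eq0 mulf_eq0 invr_eq0.
by rewrite (negbTE (node_weight_neq0 Pd i)) orbF => /eqP.
Qed.

Lemma residue0 (P : 'M[K]_(n.+2, 2)) i : residue P 0 i = 0.
Proof. by rewrite /residue /form_eval mulmx0 mxE mul0r oppr0. Qed.

Lemma canonical_basis_inj (c : 'cV[K]_n.+1) : A *m c = 0 -> B *m c = 0 -> c = 0.
Proof.
move=> Ac Bc; have /row_fullP[L LAB] := AB.1.
by rewrite -(mul1mx c) -LAB -mulmxA mul_col_mx Ac Bc col_mx0 mulmx0.
Qed.

Lemma canonical_fst_inj (c : 'cV[K]_n.+1) : A *m c = 0 -> c = 0.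
Proof.
move=> Ac; apply: canonical_basis_inj => //; apply: (residues_eq0 gb.2) => i.
by have := canonical_columns c i; rewrite Ac residue0 add0r.
Qed.

Lemma canonical_snd_inj (c : 'cV[K]_n.+1) : B *m c = 0 -> c = 0.
Proof.
move=> Bc; apply: canonical_basis_inj => //; apply: (residues_eq0 gb.1) => i.
by have := canonical_columns c i; rewrite Bc residue0 addr0.
Qed.

End CanonicalCurve.

Lemma unitmx_cols_inj (K : fieldType) n (A : 'M[K]_n) :
  (forall c : 'cV_n, A *m c = 0 -> c = 0) -> A \in unitmx.
Proof.
move=> Ainj; rewrite -unitmx_tr -row_free_unit; apply: inj_row_free => v vA.
apply: trmx_inj; rewrite trmx0; apply: Ainj.
by rewrite -[A]trmxK -trmx_mul vA trmx0.
Qed.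

Lemma veronese_neq0 (K : fieldType) n (t : 'rV[K]_2) : t != 0 -> veronese n t != 0.
Proof.
apply: contraNneq => v0; apply/eqP; apply: row2P; rewrite mxE; apply/eqP.
  have /rowP/(_ 0)/eqP := v0; rewrite !mxE subn0 expr0 mulr1 expf_eq0.
  by case/andP.
have /rowP/(_ ord_max)/eqP := v0; rewrite !mxE subnn expr0 mul1r expf_eq0.
by case/andP.
Qed.

Lemma scroll_lift (K : numFieldType) n d (a : 'I_d -> nat)
    (M : 'M[K]_(\sum_(i < d) (a i).+1, n.+1))
    (M' : 'M[K]_(n.+1, \sum_(i < d) (a i).+1)) (A : 'M[K]_n.+1) :
  M *m M' = 1%:M -> A \in unitmx ->
  rational_curve A `<=`
    proj_image [set ty | ty.1 != 0 /\ ty.2 != 0] (scroll_map M) ->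
  forall t, t != 0 -> exists ty : 'rV[K]_2 * 'rV[K]_d, exists c,
    veronese n t *m (A *m M') =
    c *: \mxrow_(i < d) (ty.2 0 i *: veronese (a i) ty.1).
Proof.
move=> MM' Au sub t t0.
have [|x0 [ty _ /andP[/sub_rVP[c vE] _]]] := sub (veronese n t *m A).
  split; last by exists t => //; rewrite submx_refl.
  apply: contraNneq (veronese_neq0 n t0) => vA.
  by rewrite -(mulmxK Au (veronese n t)) vA mul0mx.
exists ty, c; rewrite mulmxA vE -scalemxAl /scroll_map -mulmxA MM'.
by rewrite mulmx1.
Qed.

Lemma bad_of_scroll (K : numFieldType) n (g : gluing K n) (A B : 'M[K]_n.+1) d
    (S : set 'rV[K]_n.+1) :
  (3 <= n)%N -> binary_curve g -> canonical_basis g A B -> (d.*2 <= n)%N ->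
  rational_normal_scroll d S -> canonical_curve A B `<=` S ->
  bad_gluing n./2.+1 g.
Proof.
move=> n3 gb AB dn [a [M [apos aE [/row_freeP[M' MM'] _] ->]]] sub.
have Au := unitmx_cols_inj (canonical_fst_inj gb AB).
have Bu := unitmx_cols_inj (canonical_snd_inj gb AB).
have M'inj (Y : 'M[K]_n.+1) : Y \in unitmx ->
    forall c : 'cV_(\sum_(i < d) (a i).+1), Y *m M' *m c = 0 -> c = 0.
  move=> Yu c e; rewrite -(mul1mx c) -MM' -mulmxA -[M' *m c](mulKmx Yu).
  by rewrite [Y *m _]mulmxA e !mulmx0.
have subA := subset_trans (@subsetUl _ _ _) sub.
have subB := subset_trans (@subsetUr _ _ _) sub.
have [k1 [s0 [s1 [h [[k1n [ss0 ss1]] [sh hfree] [topA botA] nzA freeA]]]]] :=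
  scroll_pencil (M'inj A Au) (scroll_lift MM' Au subA) apos.
have [k2 [t0 [t1 [h' [[k2n [st0 st1]] [sh' hfree'] [topB botB] nzB freeB]]]]] :=
  scroll_pencil (M'inj B Bu) (scroll_lift MM' Bu subB) apos.
(* With this count, n + 2 <= |W| + m reads d <= floor(n/2). *)
have Wcard : (#|scroll_index a| + d = n.+1)%N.
  rewrite -aE card_tagged sumnE big_map big_enum /=; congr (_ + _)%N.
  by apply: eq_bigr => i _; rewrite card_ord.
have [i0 ai0] := apos; pose w0 : scroll_index a := Tagged (fun i => 'I_(a i)) (Ordinal ai0).
(* Opposite residues of one linear form on the two components: the gluing constants depend on the
   node only, not on the entry. *)
have entry i (j : 'I_(a i).+1) l : (node_weight g.1 l)^-1 *
    heval n (scroll_entry (A *m M') i j) (row l g.1) =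
    - (node_weight g.2 l)^-1 * heval n (scroll_entry (B *m M') i j) (row l g.2).
  have := canonical_columns AB (col j (submxrow M' i)) l; rewrite !residueE.
  rewrite /scroll_entry -!mul_submxrow !colE !mulmxA => /eqP; rewrite addr_eq0.
  by rewrite eqr_opp mulrC => /eqP ->; rewrite mulrC mulNr.
apply: (@bad_of_pencils K n g gb _ _ k1 k2 s0 s1 t0 t1 h h') => //.
- by lia.
- by lia.
- by exists w0; apply: (independent_neq0 w0 hfree').
- apply/negP => /negP; rewrite negb_or !negbK => /andP[/eqP t00 /eqP t10].
  have [] := freeB 1 0; last by move/eqP; rewrite oner_eq0.
  by rewrite t00 t10 !scaler0 addr0.
- move=> l; exists (node_weight g.1 l)^-1, (- (node_weight g.2 l)^-1).
  split=> [||w].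
  + by rewrite invr_eq0 node_weight_neq0 //; case: gb.
  + by rewrite oppr_eq0 invr_eq0 node_weight_neq0 //; case: gb.
  by rewrite -!hevalM // !subnKC // -topA -botA -topB -botB !entry.
move=> l; have := nzA (row l g.1); rewrite node_neq0; last by case: gb.
by case/(_ isT)/orP => ->; rewrite ?orbT.
Qed.

Theorem theorem5p5 (R : realType) (n : nat) (hn : (3 <= n)%N) :
  for_general_binary_curve (fun g : gluing R[i] n =>
    forall A B : 'M[R[i]]_n.+1, canonical_basis g A B ->
      ~ exists (d : nat) (S : set 'rV[R[i]]_n.+1),
          [/\ (d.*2 <= n)%N, rational_normal_scroll d S &
              canonical_curve A B `<=` S]).
Proof.
have mn : (n./2.+1.*2 <= n.+2)%N.
  by rewrite doubleS !ltnS -[leqRHS]odd_double_half leq_addl.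
have [U [Uopen Udense Ubad]] := @general_binary_curve_not_bad R[i] n _ mn.
exists U; split=> // g gb Ug A B AB [d [S [dn scr sub]]].
exact: (Ubad g gb Ug) (bad_of_scroll hn gb AB dn scr sub).
Qed.
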